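(* Let $(X,\rho)$ be a quasi-metric space and let $\mu$ be a positive Borel measure on $X$ satisfying the doubling condition. Let $1<p<\infty$. Then for every weight $w\in A_p$ and every $f\in L^p_w$, $$\|Mf\|_{L^p_w}\le C\,\|w\|_{A_p}^{1/(p-1)}\,\|f\|_{L^p_w},$$ where the constant $C$ depends only on $X$, $\mu$ and $p$.
   Context: A quasi-metric $\rho$ on $X$ satisfies the axioms of a metric except that the triangle inequality is weakened to $\rho(x,y)\le A_0(\rho(x,z)+\rho(z,y))$ with $A_0\ge1$. Balls are $B(x,r):=\{y\in X:\rho(y,x)<r\}$, $r>0$, and $2B$ denotes the ball with the same centre as $B$ and twice the radius. The topology consists of the sets $U$ such that each $x\in U$ has some $B(x,\varepsilon)\subseteq U$. The doubling condition on $\mu$: $\mu(2B)\le C\mu(B)$ for all balls $B$ with a constant $C$ independent of $B$; balls are taken to be measurable and $0<\mu(B)<\infty$ for all balls $B$. $L^1_{\mathrm{loc}}(X,\mu)$ is the set of measurable functions integrable on balls. A weight is a function $w\ge0$, $w\in L^1_{\mathrm{loc}}(X,\mu)$; $w(E):=\int_E w\,d\mu$. With $\sigma:=w^{-1/(p-1)}$ and $\sigma(E):=\int_E\sigma\,d\mu$, $$\|w\|_{A_p}:=\sup_B\frac{w(B)\,\sigma(B)^{p-1}}{\mu(B)^p},$$ the supremum being over all balls; $w\in A_p$ means $\|w\|_{A_p}<\infty$. $\|f\|_{L^p_w}:=(\int_X|f|^pw\,d\mu)^{1/p}$. The Hardy--Littlewood maximal operator is $Mf(x):=\sup_{B\ni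 x}\frac1{\mu(B)}\int_B|f|\,d\mu$, the supremum being over all balls $B$ containing $x$. *)

(* Defs.v *)
From HB Require Import structures.
From mathcomp Require Import all_boot all_order all_algebra.
From mathcomp Require Import all_classical all_reals all_analysis.

Set Implicit Arguments.
Unset Strict Implicit.
Unset Printing Implicit Defensive.

Import Order.TTheory GRing.Theory Num.Theory.
Import numFieldNormedType.Exports.

Local Open Scope classical_set_scope.
Local Open Scope ring_scope.

Definition quasi_metric (R : realType) (X : Type) (rho : X -> X -> R) : Prop :=
  [/\ forall x y, 0 <= rho x y,
      forall x y, rho x y = 0 <-> x = y,
      forall x y, rho x y = rho y x
    & exists2 A0 : R, 1 <= A0 &
        forall x y z, rho x y <= A0 * (rho x z + rho z y)].

Definition qball (R : realType) (X : Type) (rho : X -> X -> R)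
  (x : X) (r : R) : set X := [set y | rho y x < r].

(* Balls need not belong to this topology. *)
Definition qopen (R : realType) (X : Type) (rho : X -> X -> R)
  (U : set X) : Prop :=
  forall x, U x -> exists2 e : R, 0 < e & qball rho x e `<=` U.

(* The sigma-algebra of X contains the Borel sets of rho and the balls; since
   balls need not be Borel, it is not required to be generated by the open
   sets. *)
Definition borel_doubling (R : realType) (d : measure_display)
  (X : measurableType d) (rho : X -> X -> R)
  (mu : {measure set X -> \bar R}) : Prop :=
  [/\ forall U, qopen rho U -> measurable U,
      forall x r, 0 < r -> measurable (qball rho x r),
      forall x r, 0 < r -> (0 < mu (qball rho x r) < +oo)%E
    & exists D : R, forall x r, 0 < r ->
        (mu (qball rho x (2 * r)) <= D%:E * mu (qball rho x r))%E].

Definition is_weight (R : realType) (d : measure_display)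
  (X : measurableType d) (rho : X -> X -> R)
  (mu : {measure set X -> \bar R}) (w : X -> R) : Prop :=
  [/\ forall x, 0 <= w x, measurable_fun [set: X] w
    & forall x r, 0 < r -> mu.-integrable (qball rho x r) (EFin \o w)].

(* sigma = w^(-1/(p-1)), extended-real valued: it is +oo where w vanishes
   (whereas 0 `^ (- a) = 0 for the real power, but 0^-1 = +oo in \bar R). *)
Definition dual_weight (R : realType) (X : Type) (p : R) (w : X -> R)
  (x : X) : \bar R := (((w x) `^ (p - 1)^-1)%:E^-1)%E.

Definition Ap_const (R : realType) (d : measure_display)
  (X : measurableType d) (rho : X -> X -> R)
  (mu : {measure set X -> \bar R}) (p : R) (w : X -> R) : \bar R :=
  ereal_sup [set t : \bar R | exists x : X, exists2 r : R, 0 < r &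
    t = ((\int[mu]_(y in qball rho x r) (w y)%:E)
         * (\int[mu]_(y in qball rho x r) dual_weight p w y) `^ (p - 1)
         / (mu (qball rho x r)) `^ p)%E].

Definition is_Ap (R : realType) (d : measure_display)
  (X : measurableType d) (rho : X -> X -> R)
  (mu : {measure set X -> \bar R}) (p : R) (w : X -> R) : Prop :=
  is_weight rho mu w /\ (Ap_const rho mu p w < +oo)%E.

(* Extended-real valued g, so that it applies to Hardy-Littlewood maximal
   functions; here 0 * +oo = 0. *)
Definition Lpw_norm (R : realType) (d : measure_display)
  (X : measurableType d) (mu : {measure set X -> \bar R}) (p : R)
  (w : X -> R) (g : X -> \bar R) : \bar R :=
  ((\int[mu]_x (`|g x| `^ p * (w x)%:E)) `^ p^-1)%E.

Definition in_Lpw (R : realType) (d : measure_display)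
  (X : measurableType d) (mu : {measure set X -> \bar R}) (p : R)
  (w : X -> R) (f : X -> R) : Prop :=
  measurable_fun [set: X] f /\ (Lpw_norm mu p w (EFin \o f) < +oo)%E.

Definition HL_max (R : realType) (d : measure_display)
  (X : measurableType d) (rho : X -> X -> R)
  (mu : {measure set X -> \bar R}) (f : X -> R) (x : X) : \bar R :=
  ereal_sup [set t : \bar R | exists z : X, exists2 r : R,
    0 < r /\ qball rho z r x &
    t = ((mu (qball rho z r))^-1
         * \int[mu]_(y in qball rho z r) `|f y|%:E)%E].

(* Main.v *)
Require Import Defs.
From mathcomp Require Import all_boot all_order all_algebra.
From mathcomp Require Import all_classical all_reals all_analysis.
From mathcomp Require Import ring lra measurable_realfun.

(** Buckley's estimate, by an argument in the spirit of Lerner's elementary proof.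

    Write [s = w ^ (- 1 / (p - 1))] for the dual weight and [K B] for a fixed
    enlargement of a ball [B].  For a weight [v] consider the maximal function
    [M_v g (x)], the supremum over the balls [B] containing [x] of the integral of
    [g v] over [B] divided by [v (K B)].  Because the denominator is the mass of the
    enlarged ball, Vitali's covering lemma gives
    [t v {M_v g >= t} <= int_{M_v g >= t} g v] for all [t > 0], whatever the weight.
    Doob's argument then bounds [M_v] on [L ^ q (v)], for [1 < q], by a constant that
    depends on [q] only ([finmax_strong_type]).

    Let [a] be the average of [g = |f| / s] that enters [M_s g] at a ball [B].  On [B]
    one has [M_s g >= a], so [a ^ (p - 1)] times [mu B] is at most the integral over
    [B] of [h w], where [h = (M_s g) ^ (p - 1) / w].  Doubling makes [mu B] and
    [mu (K B)] comparable, and multiplying by [s (K B) / mu B] brings in exactly the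
    quantity of the [A_p] condition: up to a constant,
    [M f <= ||w|| ^ (1 / (p - 1)) (M_w h) ^ (1 / (p - 1))].  Now [M_w] is bounded on
    [L ^ p' (w)] and [M_s] on [L ^ p (s)], while [h ^ p' w = (M_s g) ^ p s] and
    [g ^ p s = |f| ^ p w]; this is the theorem with the right power of [||w||]
    ([finite_buckley]).

    The maximal function need not be measurable, and the absorption in Doob's
    argument needs finite integrals.  Both points are met by a countable family of
    balls, which contains up to a constant factor a representative of every ball
    ([countable_ball_family]): the estimates are proved for finitely many of its
    members, where all functions are measurable and take finitely many values, and
    monotone convergence concludes ([buckley_nondegenerate]).  A weight that vanishes
    almost everywhere also belongs to [A_p], with constant 0, and is treated apart
    ([Ap_weight_dichotomy], [buckley_null]). *)

Set Implicit Arguments.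
Unset Strict Implicit.
Unset Printing Implicit Defensive.

Import Order.TTheory GRing.Theory Num.Theory.

Local Open Scope classical_set_scope.
Local Open Scope ring_scope.

(** * Two elementary inequalities for real powers *)
Section real_inequalities.
Context {R : realType}.
Implicit Types a b g m q : R.

Lemma powR_mul_pred x q : 0 <= x -> 1 < q -> x * x `^ (q - 1) = x `^ q.
Proof. by move=> x0 q1; apply: mulr_powRB1 => //; lra. Qed.

(** This compares the layer-cake densities of [x ^ q] and of [x ^ (q - 1)]: it is
    Young's inequality for the product of [a] and [b ^ (q - 1)]. *)
Lemma powR_sub_le a b q : 1 < q -> 0 <= b -> b <= a ->
  a `^ q - b `^ q <= q / (q - 1) * (a * (a `^ (q - 1) - b `^ (q - 1))).
Proof.
move=> q1 b0 ba; have a0 : 0 <= a := le_trans b0 ba.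
have q0 : 0 < q by lra.
have q'0 : 0 < q / (q - 1) by rewrite divr_gt0// subr_gt0.
have : a * b `^ (q - 1) <= a `^ q / q + (b `^ (q - 1)) `^ (q / (q - 1)) / (q / (q - 1)).
  apply: conjugate_powR => //; first exact: powR_ge0.
  by field; apply/andP; split; lra.
rewrite -powRrM (_ : (q - 1) * (q / (q - 1)) = q); last by field; lra.
move=> H.
have := ler_wpM2l (ltW q'0) H.
rewrite mulrBr powR_mul_pred// => {}H.
have -> : a `^ q - b `^ q = q / (q - 1) * a `^ q -
   q / (q - 1) * (a `^ q / q + b `^ q / (q / (q - 1))).
  by field; apply/andP; split; lra.
by rewrite mulrBr; lra.
Qed.

Definition young_const q : R := q / (q - 1) * (2 * (q / (q - 1))) `^ (q - 1).

Lemma young_const_gt0 q : 1 < q -> 0 < young_const q.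
Proof.
move=> q1; have q'0 : 0 < q / (q - 1) by rewrite divr_gt0//; lra.
rewrite /young_const; move: (q / (q - 1)) q'0 => q' q'0.
by rewrite mulr_gt0 ?powR_gt0 ?mulr_gt0.
Qed.

(** A form of Young's inequality whose coefficient in front of [m ^ q] is below 1,
    so that this term can be absorbed.  The first term alone suffices when
    [m >= 2 q' g] with [q' = q / (q - 1)], and the second one otherwise. *)
Lemma young_half g m q : 1 < q -> 0 <= g -> 0 <= m ->
  q / (q - 1) * (g * m `^ (q - 1)) <= 2^-1 * m `^ q + young_const q * g `^ q.
Proof.
move=> q1 g0 m0.
have q'0 : 0 < q / (q - 1) by rewrite divr_gt0//; lra.
have C0 : 0 <= young_const q by rewrite mulr_ge0 ?powR_ge0// ltW.
rewrite /young_const in C0 *; move: (q / (q - 1)) q'0 C0 => q' q'0 C0.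
have [gm|mg] := leP (2 * q' * g) m.
  rewrite -[leLHS]addr0; apply: lerD; last by rewrite mulr_ge0// powR_ge0.
  rewrite -(@powR_mul_pred m q)// !mulrA; apply: ler_wpM2r; first exact: powR_ge0.
  lra.
rewrite -[leLHS]add0r; apply: lerD; first by rewrite mulr_ge0 ?powR_ge0//; lra.
rewrite -[in leRHS](@powR_mul_pred g q)// -[leRHS]mulrA.
apply: ler_wpM2l; first exact: ltW.
rewrite [leRHS]mulrCA ler_wpM2l// -powRM//; last by rewrite mulr_ge0// ltW.
have q'g0 : 0 <= 2 * q' * g by rewrite !mulr_ge0// ltW.
apply: ge0_ler_powR; rewrite ?nnegrE//; last exact: ltW.
by rewrite subr_ge0 ltW.
Qed.

End real_inequalities.

(** * From Doob-type weak inequalities to strong ones *)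
Section nonneg_real_integral.
Local Open Scope ereal_scope.
Context d (X : measurableType d) (R : realType) (mu : {measure set X -> \bar R}).
Implicit Types (f g : X -> R) (A : set X).

Lemma nnintD f g : measurable_fun setT f -> measurable_fun setT g ->
  (forall x, 0 <= f x)%R -> (forall x, 0 <= g x)%R ->
  \int[mu]_x (f x + g x)%:E = \int[mu]_x (f x)%:E + \int[mu]_x (g x)%:E.
Proof.
move=> mf mg f0 g0; under eq_integral do rewrite EFinD.
by rewrite ge0_integralD//; solve [exact/measurable_EFinP
  | by move=> x _; rewrite lee_fin].
Qed.

Lemma nnintZ f (k : R) : measurable_fun setT f -> (forall x, 0 <= f x)%R ->
  (0 <= k)%R -> \int[mu]_x (k * f x)%:E = k%:E * \int[mu]_x (f x)%:E.
Proof.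
move=> mf f0 k0; under eq_integral do rewrite EFinM.
by rewrite ge0_integralZl_EFin//; solve [exact/measurable_EFinP
  | by move=> x _; rewrite lee_fin].
Qed.

Lemma nnint_le f g : measurable_fun setT f -> measurable_fun setT g ->
  (forall x, 0 <= f x)%R -> (forall x, f x <= g x)%R ->
  \int[mu]_x (f x)%:E <= \int[mu]_x (g x)%:E.
Proof.
by move=> mf mg f0 fg; apply: ge0_le_integral => //;
  solve [exact/measurable_EFinP | by move=> x _; rewrite lee_fin].
Qed.

Lemma nnint_ge0 f : (forall x, 0 <= f x)%R -> 0 <= \int[mu]_x (f x)%:E.
Proof. by move=> f0; apply: integral_ge0 => x _; rewrite lee_fin. Qed.

Lemma nnint_set f A : \int[mu]_(x in A) (f x)%:E = \int[mu]_x (\1_A x * f x)%:E.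
Proof.
rewrite integral_mkcond epatch_indic; apply: eq_integral => x _ /=.
by rewrite muleC EFinM.
Qed.

End nonneg_real_integral.

Lemma measurable_powR_comp d (X : measurableType d) (R : realType) (f : X -> R) (q : R) :
  measurable_fun setT f -> measurable_fun setT (fun x => f x `^ q).
Proof. by move=> mf; apply: (measurableT_comp (measurable_powR _)). Qed.

Section layer_cake.
Context d (X : measurableType d) (R : realType) (mu : {measure set X -> \bar R}).
Variables (v g m : X -> R) (q : R).
Hypotheses (q1 : 1 < q) (mv : measurable_fun setT v) (mg : measurable_fun setT g)
  (mm : measurable_fun setT m).
Hypotheses (v0 : forall x, 0 <= v x) (g0 : forall x, 0 <= g x) (m0 : forall x, 0 <= m x).
Hypothesis weak : forall t, 0 < t ->
  (t%:E * \int[mu]_(x in [set x | (t <= m x)%R]) (v x)%:E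
    <= \int[mu]_(x in [set x | (t <= m x)%R]) (g x * v x)%:E)%E.

Let q'0 : 0 <= q / (q - 1).
Proof. by rewrite divr_ge0//; move: q1; lra. Qed.

Let mlevel t : measurable [set x | t <= m x].
Proof.
rewrite -[X in measurable X]setTI.
have -> : [set x | t <= m x] = m @^-1` `[t, +oo[.
  by apply/seteqP; split => x /=; rewrite in_itv/= andbT.
exact: mm.
Qed.

Let mexcess (b r : R) : measurable_fun setT (fun x => Num.max (m x) b `^ r - b `^ r).
Proof.
apply: measurable_funB => //; apply: measurable_powR_comp.
by apply: measurable_maxr.
Qed.

Let excess_ge0 (b r : R) x : 0 <= b -> 0 <= r ->
  0 <= Num.max (m x) b `^ r - b `^ r.
Proof.
move=> b0 r0; rewrite subr_ge0; apply: ge0_ler_powR => //.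
- by rewrite nnegrE le_max b0 orbT.
- by rewrite le_max lexx orbT.
Qed.

(* No value of [m] lies strictly between [b] and [a], so raising the truncation
   level from [b] to [a] removes one layer of constant height. *)
Let excess_step (b a r : R) x : b <= a -> 0 <= r -> (m x <= b) \/ (a <= m x) ->
  Num.max (m x) b `^ r - b `^ r =
  (Num.max (m x) a `^ r - a `^ r) + (a `^ r - b `^ r) * \1_[set x | a <= m x] x.
Proof.
move=> ba r0; rewrite indicE; case => [mb|am].
  rewrite !max_r//; last exact: le_trans ba.
  have [am|am] := boolP (a <= m x); last first.
    by rewrite memNset ?mulr0 ?subrr ?addr0// => /=; exact/negP.
  have ab : a <= b by apply: le_trans am _.
  have -> : a = b by apply/eqP; rewrite eq_le ab.
  by rewrite !subrr mul0r addr0.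
rewrite !max_l//; last exact: le_trans am.
by rewrite mem_set//=; ring.
Qed.

(* The list [s] enumerates the values of [m] above [b] in increasing order; each
   step of the induction peels off one layer, on which [weak] applies. *)
Let layer_cake_path (s : seq R) (b : R) : 0 <= b -> path <=%R b s ->
  (forall x, m x <= b \/ m x \in s) ->
  (\int[mu]_x ((Num.max (m x) b `^ q - b `^ q) * v x)%:E <=
   (q / (q - 1))%:E * \int[mu]_x ((Num.max (m x) b `^ (q - 1) - b `^ (q - 1))
     * (g x * v x))%:E)%E.
Proof.
have qge0 : 0 <= q by move: q1; lra.
have q1ge0 : 0 <= q - 1 by move: q1; lra.
have mgv : measurable_fun setT (fun x => g x * v x) by exact: measurable_funM.
have gv0 x : 0 <= g x * v x by rewrite mulr_ge0.
elim: s b => [|a s ih] b b0 /=.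
  move=> _ mb; rewrite integral0_eq; last first.
    by move=> x _; case: (mb x) => // {}mb; rewrite max_r// subrr mul0r.
  by rewrite mule_ge0 ?lee_fin//; apply: nnint_ge0 => x; rewrite mulr_ge0// excess_ge0.
move=> /andP[ba pas] mb.
have a0 : 0 <= a by exact: le_trans ba.
have gap x : m x <= b \/ a <= m x.
  case: (mb x) => [|]; first by left.
  rewrite inE => /predU1P[->|ms]; first by right.
  by right; move: pas; rewrite path_sortedE; [case/andP => /allP/(_ _ ms)|exact: le_trans].
have {}ih := ih a a0 pas _.
have mindic : measurable_fun setT (\1_[set x | a <= m x] : X -> R).
  by apply: measurable_indic.
have powab r : 0 <= r -> 0 <= a `^ r - b `^ r.
  by move=> r0; rewrite subr_ge0 ge0_ler_powR// ?nnegrE.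
have split_int (r : R) (u : X -> R) : 0 <= r -> measurable_fun setT u ->
    (forall x, 0 <= u x) ->
    (\int[mu]_x ((Num.max (m x) b `^ r - b `^ r) * u x)%:E =
     \int[mu]_x ((Num.max (m x) a `^ r - a `^ r) * u x)%:E +
     (a `^ r - b `^ r)%:E * \int[mu]_(x in [set x | (a <= m x)%R]) (u x)%:E)%E.
  move=> r0 mu' u0; rewrite nnint_set -nnintZ//; last 3 first.
  - exact: measurable_funM.
  - by move=> x; rewrite mulr_ge0.
  - exact: powab.
  rewrite -nnintD//.
  - by apply: eq_integral => x _; rewrite (excess_step ba r0 (gap x)) mulrDl mulrA.
  - exact: measurable_funM.
  - by apply: measurable_funM => //; exact: measurable_funM.
  - by move=> x; rewrite mulr_ge0// excess_ge0.
  - by move=> x; rewrite mulr_ge0 ?powab// mulr_ge0.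
rewrite !split_int// [leRHS]ge0_muleDr; last 2 first.
- by apply: nnint_ge0 => x; rewrite mulr_ge0// excess_ge0.
- by rewrite mule_ge0 ?lee_fin ?powab// integral_ge0// => x _; rewrite lee_fin.
apply: leeD.
  apply: ih => x; case: (mb x) => [mxb|]; first by left; exact: le_trans ba.
  by rewrite inE => /predU1P[->|]; [left|right].
move: a0; rewrite le_eqVlt => /predU1P[a0|a0].
  have -> : b = a by apply/eqP; rewrite eq_le ba -a0.
  by rewrite !subrr !mul0e mule0.
apply: (@le_trans _ _ ((q / (q - 1) * (a `^ (q - 1) - b `^ (q - 1)))%:E *
    (a%:E * \int[mu]_(x in [set x | (a <= m x)%R]) (v x)%:E))%E).
  rewrite muleA -EFinM; apply: lee_wpmul2r.
    by apply: integral_ge0 => x _; rewrite lee_fin.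
  rewrite lee_fin mulrC mulrCA; exact: powR_sub_le.
rewrite [leRHS]muleA -EFinM; apply: lee_wpmul2l; first by rewrite lee_fin mulr_ge0// powab.
exact: weak.
Qed.

(** Doob's argument: the layer-cake formula turns the weak inequality, whose
    right-hand side is localized to the level set itself, into an inequality
    between integrals.  As [m] takes finitely many values, the layer-cake formula
    is a finite sum. *)
Lemma doob_finite_valued (s : seq R) : (forall x, m x \in s) ->
  (\int[mu]_x (m x `^ q * v x)%:E <=
   (q / (q - 1))%:E * \int[mu]_x (m x `^ (q - 1) * (g x * v x))%:E)%E.
Proof.
move=> ms.
have qn0 : q != 0 by apply/eqP => q0; move: q1; rewrite q0; lra.
have q1n0 : q - 1 != 0 by rewrite subr_eq0 gt_eqF.
have := @layer_cake_path (sort <=%R [seq y <- s | 0 <= y]) 0 (lexx _) _ _.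
rewrite !powR0// => H.
have maxm0 x : Num.max (m x) 0 = m x by rewrite max_l.
have E (r : R) (u : X -> R) : (\int[mu]_x ((Num.max (m x) 0 `^ r - 0) * u x)%:E =
    \int[mu]_x (m x `^ r * u x)%:E)%E.
  by apply: eq_integral => x _; rewrite maxm0 subr0.
rewrite !E in H; apply: H.
- rewrite path_sortedE; last exact: le_trans.
  rewrite (sort_sorted le_total) andbT.
  by apply/allP => y; rewrite mem_sort mem_filter => /andP[].
- by move=> x; right; rewrite mem_sort mem_filter m0 ms.
Qed.

(** Half of the left-hand side is absorbed, which is why it has to be finite; this
    takes the place of Hoelder's inequality. *)
Lemma strong_type_of_weak (s : seq R) : (forall x, m x \in s) ->
  (\int[mu]_x (m x `^ q * v x)%:E < +oo)%E ->
  (\int[mu]_x (m x `^ q * v x)%:E <=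
   (2 * young_const q)%:E * \int[mu]_x (g x `^ q * v x)%:E)%E.
Proof.
move=> ms fin.
have Y a b := @young_half R a b q q1; have Cgt0 := young_const_gt0 q1.
move: (young_const q) Cgt0 Y => C Cgt0 Y; have C0 := ltW Cgt0.
have mmq r : measurable_fun setT (fun x => m x `^ r) by exact: measurable_powR_comp.
have mgq r : measurable_fun setT (fun x => g x `^ r) by exact: measurable_powR_comp.
have mmqv : measurable_fun setT (fun x => m x `^ q * v x) by exact: measurable_funM.
have mgqv : measurable_fun setT (fun x => g x `^ q * v x) by exact: measurable_funM.
have mgv : measurable_fun setT (fun x => g x * v x) by exact: measurable_funM.
have mmgv : measurable_fun setT (fun x => m x `^ (q - 1) * (g x * v x)).
  exact: measurable_funM.
have mmqv0 x : 0 <= m x `^ q * v x by rewrite mulr_ge0// powR_ge0.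
have mgqv0 x : 0 <= g x `^ q * v x by rewrite mulr_ge0// powR_ge0.
have mmgv0 x : 0 <= m x `^ (q - 1) * (g x * v x) by rewrite !mulr_ge0// powR_ge0.
have : (\int[mu]_x (m x `^ q * v x)%:E <=
    2^-1%:E * \int[mu]_x (m x `^ q * v x)%:E +
    C%:E * \int[mu]_x (g x `^ q * v x)%:E)%E.
  apply: le_trans (doob_finite_valued ms) _.
  rewrite -!nnintZ// -nnintD//; last 4 first.
  - exact: measurable_funM.
  - exact: measurable_funM.
  - by move=> x; rewrite mulr_ge0.
  - by move=> x; rewrite mulr_ge0.
  apply: nnint_le.
  - exact: measurable_funM.
  - by apply: measurable_funD; exact: measurable_funM.
  - by move=> x; rewrite mulr_ge0.
  - move=> x; rewrite !mulrA -mulrDl ler_wpM2r//.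
    by rewrite -mulrA [_ * g x]mulrC; exact: Y.
have A0 : (0 <= \int[mu]_x (m x `^ q * v x)%:E)%E.
  by apply: nnint_ge0 => x; rewrite mulr_ge0// powR_ge0.
have B0 : (0 <= \int[mu]_x (g x `^ q * v x)%:E)%E.
  by apply: nnint_ge0 => x; rewrite mulr_ge0// powR_ge0.
move: fin A0 B0; case: (\int[mu]_x (m x `^ q * v x)%:E)%E => [A| |]//.
case: (\int[mu]_x (g x `^ q * v x)%:E)%E => [B| |]// _.
  by rewrite !lee_fin => *; lra.
move=> A0 _ _.
by rewrite gt0_muley ?leey// lte_fin mulr_gt0.
Qed.

End layer_cake.

(** * The maximal function of a finite family of sets *)
Definition finmax (R : realType) (X : Type) (a : nat -> R) (B : nat -> set X)
    (N : nat) (x : X) : R :=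
  \big[Num.max/0]_(i < N) (a i * \1_(B i) x).

Section finmax_theory.
Context (R : realType) (X : Type) (a : nat -> R) (B : nat -> set X).

Lemma finmax_ge0 N x : 0 <= finmax a B N x.
Proof. exact: bigmax_ge_id. Qed.

Lemma le_finmax N i x : (i < N)%N -> B i x -> a i <= finmax a B N x.
Proof.
move=> iN Bx; have := le_bigmax 0 (fun i : 'I_N => a i * \1_(B i) x) (Ordinal iN).
by rewrite /= indicE mem_set// mulr1.
Qed.

Lemma finmax_le N x c : 0 <= c -> (forall i, (i < N)%N -> B i x -> a i <= c) ->
  finmax a B N x <= c.
Proof.
move=> c0 H; apply: bigmax_le => // i _; rewrite indicE.
have [Bx|Bx] := pselect (B i x); first by rewrite mem_set// mulr1 H.
by rewrite memNset// mulr0.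
Qed.

Lemma finmax_attained N x t : 0 < t -> t <= finmax a B N x ->
  exists i, [/\ (i < N)%N, B i x & t <= a i].
Proof.
move=> t0 /bigmax_geP[|[i _]]; first by rewrite leNgt t0.
rewrite indicE; have [Bx|Bx] := pselect (B i x); last first.
  by rewrite memNset// mulr0 leNgt t0.
by rewrite mem_set// mulr1 => ta; exists i.
Qed.

Lemma finmax_values N x : finmax a B N x \in 0 :: [seq a i | i <- iota 0 N].
Proof.
rewrite /finmax; elim/big_ind : _ => [|y z ys zs|i _]; first by rewrite inE eqxx.
  by rewrite maxEle; case: ifP.
rewrite indicE; case: (_ \in _); last by rewrite mulr0 inE eqxx.
by rewrite mulr1 inE map_f ?orbT// mem_iota /=.
Qed.

Lemma finmax_homo x : {homo (fun N => finmax a B N x) : n m / (n <= m)%N >-> n <= m}.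
Proof.
move=> n m nm; apply: finmax_le; first exact: finmax_ge0.
by move=> i ni Bx; apply: le_finmax => //; exact: leq_trans nm.
Qed.

End finmax_theory.

Lemma measurable_finmax (R : realType) d (X : measurableType d) (a : nat -> R)
    (B : nat -> set X) N : (forall i, measurable (B i)) ->
  measurable_fun setT (finmax a B N).
Proof.
move=> mB; rewrite /finmax; elim: (index_enum _) => [|i s ih].
  by under eq_fun do rewrite big_nil; exact: measurable_cst.
under eq_fun do rewrite big_cons.
by apply: measurable_maxr => //; exact: measurable_funM.
Qed.

(** The conclusion of Vitali's covering lemma, with [K i] standing for the
    enlargement of [B i]; this is all that the maximal inequality needs to know
    about the geometry. *)
Definition vitali_cover (X : Type) (B K : nat -> set X) : Prop :=
  forall s : seq nat, exists J : seq nat,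
    [/\ {subset J <= s}, uniq J, trivIset [set` J] B &
        forall i x, i \in s -> B i x -> exists2 j, j \in J & K j x].

(** The averages [a i] integrate [g] over [B i] but divide by the mass of the larger
    set [K i].  This gap pays for the enlargement in Vitali's lemma, so the
    constants below do not involve any doubling property of the weight [v]. *)
Section finite_maximal_inequality.
Context d (X : measurableType d) (R : realType) (mu : {measure set X -> \bar R}).
Variables (B K : nat -> set X) (v g : X -> R) (a : nat -> R).
Hypotheses (mB : forall i, measurable (B i)) (mK : forall i, measurable (K i)).
Hypotheses (BK : forall i, B i `<=` K i) (vit : vitali_cover B K).
Hypotheses (mv : measurable_fun setT v) (mg : measurable_fun setT g).
Hypotheses (v0 : forall x, 0 <= v x) (g0 : forall x, 0 <= g x) (a0 : forall i, 0 <= a i).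
Hypothesis vK : forall i, (\int[mu]_(x in K i) (v x)%:E < +oo)%E.
Hypothesis aE : forall i, ((a i)%:E * \int[mu]_(x in K i) (v x)%:E
  = \int[mu]_(x in B i) (g x * v x)%:E)%E.

Let mlevel N t : measurable [set x | t <= finmax a B N x].
Proof.
rewrite -[X in measurable X]setTI.
have -> : [set x | t <= finmax a B N x] = finmax a B N @^-1` `[t, +oo[.
  by apply/seteqP; split => x /=; rewrite in_itv/= andbT.
exact: measurable_finmax.
Qed.

(** Vitali's lemma covers the level set by the [K j] of a disjoint subfamily, and the
    disjoint [B j] lie in the level set again. *)
Lemma finmax_weak_type N t : 0 < t ->
  (t%:E * \int[mu]_(x in [set x | (t <= finmax a B N x)%R]) (v x)%:E
    <= \int[mu]_(x in [set x | (t <= finmax a B N x)%R]) (g x * v x)%:E)%E.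
Proof.
move=> t0.
have [J [Js uJ tJ cov]] := vit [seq i <- iota 0 N | t <= a i].
have JN j : j \in J -> (j < N)%N /\ t <= a j.
  by move/Js; rewrite mem_filter mem_iota/= => /andP[].
have mgv : measurable_fun setT (fun x => g x * v x) by exact: measurable_funM.
have step1 : (\int[mu]_(x in [set x | (t <= finmax a B N x)%R]) (v x)%:E <=
    \sum_(j <- J) \int[mu]_(x in K j) (v x)%:E)%E.
  rewrite nnint_set; under eq_bigr do rewrite nnint_set.
  rewrite -ge0_integral_sum//; last 2 first.
  - by move=> j; apply/measurable_EFinP; apply: measurable_funM => //; exact: measurable_indic.
  - by move=> j x _; rewrite lee_fin mulr_ge0.
  under [leRHS]eq_integral do rewrite /= sumEFin.
  apply: nnint_le.
  - by apply: measurable_funM => //; exact: measurable_indic.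
  - by apply: measurable_sum => j; apply: measurable_funM => //; exact: measurable_indic.
  - by move=> x; rewrite mulr_ge0.
  - move=> x; rewrite indicE; have [tx|tx] := pselect (t <= finmax a B N x); last first.
      by rewrite memNset// mul0r sumr_ge0// => j _; rewrite mulr_ge0.
    have [i [iN Bix tai]] := finmax_attained t0 tx.
    have [|j jJ Kjx] := cov i x _ Bix; first by rewrite mem_filter tai mem_iota.
    rewrite mem_set// (big_rem j)//= indicE mem_set// mul1r lerDl.
    by rewrite sumr_ge0// => k _; rewrite mulr_ge0.
apply: (@le_trans _ _ (t%:E * \sum_(j <- J) \int[mu]_(x in K j) (v x)%:E)%E).
  by apply: lee_wpmul2l => //; rewrite lee_fin ltW.
rewrite ge0_sume_distrr; last by move=> j _; apply: integral_ge0 => x _; rewrite lee_fin.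
apply: (@le_trans _ _ (\sum_(j <- J) \int[mu]_(x in B j) (g x * v x)%:E)%E).
  rewrite big_seq [leRHS]big_seq; apply: lee_sum => j /JN[_ taj].
  rewrite -aE; apply: lee_wpmul2r; last by rewrite lee_fin.
  by apply: integral_ge0 => x _; rewrite lee_fin.
rewrite -ge0_integral_bigsetU//.
- apply: ge0_subset_integral => //.
  + exact: bigsetU_measurable.
  + by apply/measurable_EFinP; exact: measurable_funTS.
  + by move=> x _; rewrite lee_fin mulr_ge0.
  + move=> x; rewrite -bigcup_seq => -[j /= jJ Bjx].
    have [jN taj] := JN _ jJ.
    by apply: le_trans taj _; exact: le_finmax.
- by apply/measurable_EFinP; exact: measurable_funTS.
- by move=> x _; rewrite lee_fin mulr_ge0.
Qed.

Let mfin N : measurable_fun setT (finmax a B N).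
Proof. exact: measurable_finmax. Qed.

Lemma finmax_integral_fin N q : 1 < q ->
  (\int[mu]_x (finmax a B N x `^ q * v x)%:E < +oo)%E.
Proof.
move=> q1.
apply: (@le_lt_trans _ _ (\sum_(i < N) ((a i `^ q)%:E * \int[mu]_(x in B i) (v x)%:E))%E).
  under eq_bigr => i _.
    rewrite nnint_set -nnintZ; [|by apply: measurable_funM => //; exact: measurable_indic
      |by move=> x; rewrite mulr_ge0|exact: powR_ge0].
    over.
  rewrite -ge0_integral_sum//; last 2 first.
  - move=> j; apply/measurable_EFinP; apply: measurable_funM => //.
    by apply: measurable_funM => //; exact: measurable_indic.
  - by move=> j x _; rewrite lee_fin !mulr_ge0// powR_ge0.
  under [leRHS]eq_integral do rewrite /= sumEFin.
  apply: nnint_le.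
  - by apply: measurable_funM => //; exact: measurable_powR_comp.
  - apply: measurable_sum => j; apply: measurable_funM => //.
    by apply: measurable_funM => //; exact: measurable_indic.
  - by move=> x; rewrite mulr_ge0// powR_ge0.
  - move=> x; have S0 : 0 <= \sum_(i < N) a i `^ q * (\1_(B i) x * v x).
      by apply: sumr_ge0 => i _; rewrite !mulr_ge0// powR_ge0.
    have := finmax_values a B N x; rewrite inE => /predU1P[->|].
      by rewrite powR0 ?mul0r//; apply/eqP; move: q1; lra.
    have [->|fn0] := eqVneq (finmax a B N x) 0.
      by rewrite powR0 ?mul0r//; apply/eqP; move: q1; lra.
    have fgt0 : 0 < finmax a B N x by rewrite lt_neqAle eq_sym fn0 finmax_ge0.
    have [i [iN Bix fai]] := finmax_attained fgt0 (lexx _).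
    move=> _; rewrite (bigD1 (Ordinal iN))//= -[leLHS]addr0; apply: lerD.
      rewrite indicE mem_set// mul1r ler_wpM2r//.
      by apply: ge0_ler_powR; rewrite ?nnegrE//; [move: q1; lra|exact: ltW].
    by apply: sumr_ge0 => j _; rewrite !mulr_ge0// powR_ge0.
apply: lte_sum_pinfty => i _; apply: lte_mul_pinfty => //.
  by rewrite lee_fin powR_ge0.
apply: le_lt_trans (vK i); apply: ge0_subset_integral => //.
- by apply/measurable_EFinP; exact: measurable_funTS.
- by move=> x _; rewrite lee_fin.
Qed.

Theorem finmax_strong_type N q : 1 < q ->
  (\int[mu]_x (finmax a B N x `^ q * v x)%:E <=
   (2 * young_const q)%:E * \int[mu]_x (g x `^ q * v x)%:E)%E.
Proof.
move=> q1; apply: (strong_type_of_weak q1 mv mg (mfin N) v0 g0) => //.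
- by move=> x; exact: finmax_ge0.
- by move=> t; exact: finmax_weak_type.
- by move=> x; exact: finmax_values.
- exact: finmax_integral_fin.
Qed.

End finite_maximal_inequality.

(** * Balls in a doubling quasi-metric space *)
Section countable_disjoint.
Context d (X : measurableType d) (R : realType) (mu : {measure set X -> \bar R}).

Lemma finite_disjoint_large (I : pointedType) (F : I -> set X) (E : set I) (G : set X) (e : R) :
  (forall i, measurable (F i)) -> measurable G -> (mu G < +oo)%E -> 0 < e ->
  trivIset E F -> (forall i, E i -> (e%:E <= mu (F i `&` G))%E) -> finite_set E.
Proof.
move=> mF mG Gfin e0 tF eF; apply: contrapT => /infiniteP/pcard_leP/injfunPex[/= f fE finj].
have mFG n : measurable (F (f n) `&` G) by exact: measurableI.
have large n : ((n%:R * e)%:E <= mu G)%E.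
  apply: (@le_trans _ _ (\sum_(i < n) mu (F (f i) `&` G))%E).
    rewrite [leLHS](_ : _ = (\sum_(i < n) e%:E)%E); last first.
      by rewrite sumEFin sumr_const card_ord mulr_natl.
    by apply: lee_sum => i _; apply: eF; exact: fE.
  rewrite -(@measure_bigsetU_ord _ _ _ mu n xpredT (fun i => F (f i) `&` G))//.
    apply: le_measure; rewrite ?inE//; first exact: bigsetU_measurable.
    by rewrite -(bigcup_mkord n (fun i => F (f i) `&` G)) => x [i _ []].
  move=> i j _ _ [x [[Fix _] [Fjx _]]].
  apply/val_inj/finj; rewrite ?inE//.
  by apply: tF; [exact: fE|exact: fE|exists x].
have Gnum : mu G \is a fin_num by rewrite ge0_fin_numE.
have := large (Num.bound (fine (mu G) / e)).
rewrite -(fineK Gnum) lee_fin leNgt => /negP; apply.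
by rewrite -ltr_pdivrMr// archi_boundP// divr_ge0 ?fine_ge0// ltW.
Qed.

Lemma countable_disjoint (I : pointedType) (F : I -> set X) (E : set I) (G : nat -> set X) :
  (forall i, measurable (F i)) -> (forall i, (0 < mu (F i))%E) ->
  (forall n, measurable (G n)) -> (forall n, (mu (G n) < +oo)%E) ->
  \bigcup_n G n = setT -> trivIset E F -> countable E.
Proof.
move=> mF F0 mG Gfin GT tF.
apply: (@sub_countable _ _ _ (\bigcup_n \bigcup_k
   [set i | E i /\ (k.+1%:R^-1%:E <= mu (F i `&` G n))%E])).
  apply: subset_card_le => i Ei.
  have [n FGn] : exists n, (0 < mu (F i `&` G n))%E.
    apply: contrapT => /forallNP H.
    have := F0 i; rewrite -[F i]setIT -GT setI_bigcupr.
    have mFG n : measurable (F i `&` G n) by exact: measurableI.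
    suff /negligibleP -> : mu.-negligible (\bigcup_n (F i `&` G n)).
    - by rewrite ltxx.
    - exact: bigcupT_measurable.
    apply: negligible_bigcup => n; apply/negligibleP => //.
    by apply/eqP; rewrite -measure_le0 leNgt; apply/negP/H.
  have [k ke] : exists k, (k.+1%:R^-1%:E <= mu (F i `&` G n))%E.
    have FGfin : mu (F i `&` G n) \is a fin_num.
      rewrite ge0_fin_numE//; apply: le_lt_trans (Gfin n).
      by apply: le_measure; rewrite ?inE//; exact: measurableI.
    move: FGn; rewrite -(fineK FGfin) lte_fin => FGn.
    have [k] := ltr_add_invr FGn; rewrite add0r => kF.
    by exists k; rewrite lee_fin ltW.
  by exists n => //; exists k.
apply: bigcup_countable => // n _; apply: bigcup_countable => // k _.
apply: finite_set_countable.
apply: (@finite_disjoint_large _ F _ (G n) k.+1%:R^-1) => //.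
- by apply: sub_trivIset tF => i [].
- by move=> i [].
Qed.

End countable_disjoint.

Lemma qball_le (R : realType) (X : Type) (rho : X -> X -> R) x r s :
  r <= s -> qball rho x r `<=` qball rho x s.
Proof. by move=> rs y /lt_le_trans; apply. Qed.

Section quasi_metric_balls.
Context (R : realType) (X : Type) (rho : X -> X -> R) (A : R).
Hypotheses (rho_ge0 : forall x y, 0 <= rho x y) (rho_refl : forall x, rho x x = 0).
Hypotheses (rho_sym : forall x y, rho x y = rho y x) (A1 : 1 <= A).
Hypothesis rho_tri : forall x y z, rho x y <= A * (rho x z + rho z y).

Let A0 : 0 < A. Proof. exact: lt_le_trans A1. Qed.

Lemma qball_center x r : 0 < r -> qball rho x r x.
Proof. by rewrite /qball /= rho_refl. Qed.

Lemma qball_sub x y r s : rho x y < s -> qball rho x r `<=` qball rho y (A * (r + s)).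
Proof.
move=> xy z; rewrite /qball/= => zx; apply: le_lt_trans (rho_tri z y x) _.
by rewrite ltr_pM2l// ltrD.
Qed.

Lemma qball_meet x y r s : qball rho x r `&` qball rho y s !=set0 ->
  rho x y < A * (r + s).
Proof.
move=> [z []]; rewrite /qball/= => zx zy; apply: le_lt_trans (rho_tri x y z) _.
by rewrite ltr_pM2l// ltrD// rho_sym.
Qed.

(** The greedy selection runs through the finite list in the order of decreasing
    radii. *)
Lemma vitali_cover_qball (z : nat -> X) (r : nat -> R) : (forall i, 0 < r i) ->
  vitali_cover (fun i => qball rho (z i) (r i)) (fun i => qball rho (z i) (3 * A ^+ 2 * r i)).
Proof.
move=> r0 s; set B := fun i => qball rho (z i) (r i).
have engulf i j : r i <= r j -> B i `&` B j !=set0 ->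
    B i `<=` qball rho (z j) (3 * A ^+ 2 * r j).
  move=> rij /qball_meet zij; apply: subset_trans (qball_sub zij) _.
  apply: qball_le; rewrite (_ : 3 * A ^+ 2 * r j = A * (3 * (A * r j))); last by ring.
  rewrite ler_pM2l// mulrDr.
  have : r i <= A * r j by apply: le_trans rij _; rewrite ler_peMl// ltW.
  have : A * r i <= A * r j by rewrite ler_pM2l.
  have : r j <= A * r j by rewrite ler_peMl// ltW.
  lra.
suff : forall s, pairwise (fun i j => r j <= r i) s -> exists J : seq nat,
    [/\ {subset J <= s}, uniq J, trivIset [set` J] B &
     forall i, i \in s -> exists j, [/\ j \in J, r i <= r j & B i `&` B j !=set0]].
  have tot : total (fun i j => r j <= r i) by move=> i j; exact: le_total.
  have tr : transitive (fun i j => r j <= r i) by move=> i j k ij jk; exact: le_trans ij.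
  move=> /(_ (sort (fun i j => r j <= r i) s)).
  rewrite -sorted_pairwise// sort_sorted// => -[//|J [Js uJ tJ cov]].
  exists J; split => //; first by move=> j /Js; rewrite mem_sort.
  move=> i x si Bix; have [|j [jJ rij Bij]] := cov i; first by rewrite mem_sort.
  by exists j => //; exact: (engulf i j).
elim/last_ind => [|{}s i ih].
  by move=> _; exists [::]; split => // i j; rewrite /= in_nil.
rewrite pairwise_rcons => /andP[/allP ri ps].
have [J [Js uJ tJ cov]] := ih ps.
have [[j [jJ Bij]]|nomeet] := pselect (exists j, j \in J /\ B i `&` B j !=set0).
  exists J; split => //; first by move=> k /Js; rewrite mem_rcons inE => ->; rewrite orbT.
  move=> k; rewrite mem_rcons inE => /predU1P[->|/cov//].
  by exists j; split => //; exact: ri (Js _ jJ).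
exists (i :: J); split.
- by move=> k; rewrite mem_rcons !inE => /predU1P[->|/Js ->]; rewrite ?eqxx ?orbT.
- rewrite /= uJ andbT; apply/negP => iJ; apply: nomeet; exists i; split => //.
  by exists (z i); split; exact: qball_center.
- move=> j k /=; rewrite !inE => /predU1P[->|jJ] /predU1P[->|kJ] //.
  + by move=> Bik; exfalso; apply: nomeet; exists k.
  + by rewrite setIC => Bik; exfalso; apply: nomeet; exists j.
  + exact: tJ.
- move=> k; rewrite mem_rcons inE => /predU1P[->|/cov[j [jJ rkj Bkj]]].
    exists i; rewrite inE eqxx; split => //.
    by exists (z i); split; exact: qball_center.
  by exists j; rewrite inE jJ orbT.
Qed.

End quasi_metric_balls.

Section doubling_geometry.
Context (R : realType) d (X : measurableType d) (rho : X -> X -> R)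
  (mu : {measure set X -> \bar R}).
Hypotheses (Hrho : quasi_metric rho) (Hmu : borel_doubling rho mu).

Lemma qball_bigcup x : \bigcup_n qball rho x n.+1%:R = setT.
Proof.
apply/seteqP; split => // y _; exists (Num.bound (rho y x)) => //.
rewrite /qball/=; case: Hrho => rho0 _ _ _.
by apply: lt_le_trans (archi_boundP (rho0 _ _)) _; rewrite ler_nat.
Qed.

(** Doubling [n] times, with [k <= 2 ^ n]. *)
Lemma doubling_iter (k : R) : exists2 D : R, 0 < D & forall x r, 0 < r ->
  (mu (qball rho x (k * r)) <= D%:E * mu (qball rho x r))%E.
Proof.
case: Hmu => _ mB B0 [D0 HD0].
pose D := Num.max D0 1.
have D1 : 1 <= D by rewrite le_max lexx orbT.
have HD x r : 0 < r -> (mu (qball rho x (2 * r)) <= D%:E * mu (qball rho x r))%E.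
  move=> r0; apply: le_trans (HD0 x r r0) _; apply: lee_wpmul2r => //.
  by rewrite lee_fin le_max lexx.
have iter n x r : 0 < r ->
    (mu (qball rho x (2 ^+ n * r)) <= (D ^+ n)%:E * mu (qball rho x r))%E.
  move=> r0; elim: n => [|n ih]; first by rewrite !expr0 mul1r mul1e.
  rewrite !exprS -mulrA; apply: le_trans (HD _ _ _) _; first by rewrite mulr_gt0// exprn_gt0.
  by rewrite EFinM -muleA; apply: lee_wpmul2l => //; rewrite lee_fin (le_trans _ D1).
pose n := Num.bound `|k|.
exists (D ^+ n); first by rewrite exprn_gt0// (lt_le_trans _ D1).
move=> x r r0; apply: le_trans (iter n x r r0); apply: le_measure; rewrite ?inE.
- have [kr0|kr0] := ltP 0 (k * r); first exact: mB.
  rewrite (_ : qball _ _ _ = set0)//; apply/seteqP; split => // y.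
  case: Hrho => rho0 _ _ _; rewrite /qball/= => /(le_lt_trans (rho0 _ _)).
  by rewrite ltNge kr0.
- by apply: mB; rewrite mulr_gt0// exprn_gt0.
- apply: qball_le; rewrite ler_pM2r// (le_trans (ler_norm _))//.
  apply: ltW; apply: lt_le_trans (archi_boundP (normr_ge0 _)) _.
  by rewrite -natrX ler_nat ltnW// ltn_expl.
Qed.

(** For every positive rational [q], a maximal disjoint family of balls of radius
    [q] is countable, being disjoint sets of positive measure in a sigma-finite
    space, and its centres form a net at scale [q]. *)
Lemma countable_ball_family : exists (z : nat -> X) (r : nat -> R) (l : R),
  (forall i, 0 < r i) /\ forall x s, 0 < s -> exists i,
    qball rho x s `<=` qball rho (z i) (r i) /\
    qball rho (z i) (r i) `<=` qball rho x (l * s).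
Proof.
case: (Hrho) => rho0 rho_eq rho_sym [A A1 tri]; case: (Hmu) => _ mB B0 _.
have A0 : 0 < A := lt_le_trans ltr01 A1.
have rhoxx x : rho x x = 0 by apply/rho_eq.
have netP (q : rat) : exists E : set X, 0 < ratr q :> R ->
    countable E /\ forall x, exists2 y, E y & rho x y < A * (ratr q + ratr q).
  pose B z := qball rho z (ratr q : R).
  have [E [_ tE maxE]] := ex_maximal_disjoint_subcollection B setT.
  exists E => q0; split.
    apply: (@countable_disjoint _ _ _ mu _ B E (fun n => qball rho point n.+1%:R)) => //.
    - by move=> i; exact: mB.
    - by move=> i; case/andP: (B0 i _ q0).
    - by move=> n; exact: mB.
    - by move=> n; case/andP: (B0 point n.+1%:R (ltr0Sn _ _)).
    - exact: qball_bigcup.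
  move=> x; have [Ex|nEx] := pselect (E x).
    by exists x => //; rewrite rhoxx mulr_gt0// addr_gt0.
  have [[y [Ey Bxy]]|nomeet] := pselect (exists y, E y /\ B x `&` B y !=set0).
    by exists y => //; exact: (qball_meet rho_sym A1 tri).
  exfalso; apply: (maxE (x |` E)) => //.
    by split; [exact: subsetUr|move=> xE; apply/nEx/xE; left].
  move=> i j /= [->|Ei] [->|Ej]//; last exact: tE.
    by move=> Bxj; exfalso; apply: nomeet; exists j.
  by rewrite setIC => Bxj; exfalso; apply: nomeet; exists i.
have {netP} [N NP] := choice netP.
pose S : set (rat * X) := \bigcup_(q in [set q | 0 < ratr q :> R]) (pair q @` N q).
have Scount : countable S.
  apply: bigcup_countable => [|q q0]; first exact: countableP.
  by apply: card_le_trans (card_image_le _ _) _; case: (NP q q0).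
have pick x s : 0 < s -> exists q z, [/\ 0 < ratr q :> R, N q z, s <= ratr q,
    (ratr q : R) <= 2 * s & rho x z < A * (ratr q + ratr q)].
  move=> s0; have [q] := @rat_in_itvoo R s (2 * s) ltac:(lra).
  rewrite in_itv/= => /andP[sq q2s]; have q0 : 0 < ratr q :> R by exact: lt_trans sq.
  have [_ /(_ x)[z Nz xz]] := NP q q0.
  by exists q, z; split => //; exact: ltW.
move/pfcard_geP : Scount => [S0|[f]].
  have [q [z [q0 Nz _ _ _]]] := pick point 1 ltr01.
  have : S (q, z) by exists q => //; exists z.
  by rewrite S0.
have fS i : S (f i) by exact: funS.
have q_gt0 i : 0 < ratr (f i).1 :> R by have [q q0 [z _ <-]] := fS i.
pose r (q : rat) : R := A * (ratr q + A * (ratr q + ratr q)).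
exists (fun i => (f i).2), (fun i => r (f i).1).
exists (A * (A * (2 + A * 4) + A * 4)); split.
  move=> i; rewrite /r; move: (ratr _) (q_gt0 i) => t t0.
  by rewrite !(mulr_gt0, addr_gt0).
move=> x s s0; have [q [z [q0 Nz sq q2s xz]]] := pick x s s0.
have [i _ fi] : (f @` setT) (q, z).
  by apply: surj; exists q => //; exists z.
exists i; rewrite fi/=; split.
  apply: subset_trans (qball_le sq) _.
  exact: (qball_sub A1 tri).
have zx : rho z x < A * (ratr q + ratr q) by rewrite rho_sym.
apply: subset_trans (qball_sub A1 tri zx) _; apply: qball_le.
rewrite /r -mulrA ler_pM2l// mulrDl; apply: lerD.
  rewrite -mulrA ler_pM2l// mulrDl; apply: lerD => //.
  by rewrite -mulrA ler_pM2l//; lra.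
by rewrite -mulrA ler_pM2l//; lra.
Qed.

End doubling_geometry.

(** * The weighted estimate for finitely many balls *)
Lemma measurable_zero_set d (X : measurableType d) (R : realType) (u : X -> R) :
  measurable_fun setT u -> measurable [set x | u x = 0].
Proof.
move=> mu; rewrite -[X in measurable X]setTI.
exact: (mu measurableT _ (measurable_set1 0)).
Qed.

(** Here [s] is the dual weight, with value 0 instead of infinity on the null set
    where [w] vanishes; [W i] and [S i] are the masses of [K i] for [w] and [s],
    [m i] the measure of [B i], and [c i] the average of [f] over [B i]. *)
Section finite_buckley.
Context d (X : measurableType d) (R : realType) (mu : {measure set X -> \bar R}).
Variables (B K : nat -> set X) (w f : X -> R) (p A C0 : R) (W S m c : nat -> R).
Hypotheses (mB : forall i, measurable (B i)) (mK : forall i, measurable (K i)).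
Hypotheses (BK : forall i, B i `<=` K i) (vit : vitali_cover B K).
Hypotheses (p1 : 1 < p) (A0 : 0 <= A) (C00 : 0 <= C0).
Hypotheses (mw : measurable_fun setT w) (w0 : forall x, 0 <= w x).
Hypotheses (mf : measurable_fun setT f) (f0 : forall x, 0 <= f x).
Let s x := w x `^ (- (p - 1)^-1).
Let p' := p / (p - 1).
Hypotheses (W0 : forall i, 0 < W i) (S0 : forall i, 0 < S i) (m0 : forall i, 0 < m i).
Hypothesis c0 : forall i, 0 <= c i.
Hypothesis WE : forall i, (\int[mu]_(x in K i) (w x)%:E = (W i)%:E)%E.
Hypothesis SE : forall i, (\int[mu]_(x in K i) (s x)%:E = (S i)%:E)%E.
Hypothesis mE : forall i, mu (B i) = (m i)%:E.
Hypothesis cE : forall i, ((c i)%:E * mu (B i) = \int[mu]_(x in B i) (f x)%:E)%E.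
Hypothesis wB : forall i, mu (B i `&` [set x | w x = 0]) = 0%E.
Hypothesis Ap : forall i, W i * S i `^ (p - 1) <= A * (C0 * m i) `^ p.
Hypothesis ffin : (\int[mu]_x (f x `^ p * w x)%:E < +oo)%E.

Let p'1 : 1 < p'.
Proof. by rewrite /p' ltr_pdivlMr; move: p1; lra. Qed.

Let p_gt0 : 0 < p. Proof. by move: p1; lra. Qed.
Let pm1 : 0 < p - 1. Proof. by move: p1; lra. Qed.

Let mnull i : measurable (B i `&` [set x | w x = 0]).
Proof.
by apply: measurableI => //; exact: measurable_zero_set.
Qed.

Let eq_int_off_null i (u v : X -> R) :
  measurable_fun setT u -> measurable_fun setT v ->
  (forall x, 0 <= u x) -> (forall x, 0 <= v x) ->
  (forall x, w x != 0 -> u x = v x) ->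
  (\int[mu]_(x in B i) (u x)%:E = \int[mu]_(x in B i) (v x)%:E)%E.
Proof.
move=> mu' mv u0 v0 uv; apply: ge0_ae_eq_integral => //.
- by apply/measurable_EFinP; exact: measurable_funTS.
- by apply/measurable_EFinP; exact: measurable_funTS.
- by move=> x _; rewrite lee_fin.
- by move=> x _; rewrite lee_fin.
exists (B i `&` [set x | w x = 0]); split => // x /= /not_implyP[Bx].
by move=> uvx; split => //; apply: contra_notP uvx => /eqP/uv ->.
Qed.

(* The bound [g <= 1 + g ^ q] makes the average finite. *)
Let avg_fin i (v g : X -> R) (q : R) : 1 < q ->
  measurable_fun setT v -> measurable_fun setT g ->
  (forall x, 0 <= v x) -> (forall x, 0 <= g x) ->
  (\int[mu]_(x in K i) (v x)%:E < +oo)%E ->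
  (\int[mu]_x (g x `^ q * v x)%:E < +oo)%E ->
  (\int[mu]_(x in B i) (g x * v x)%:E < +oo)%E.
Proof.
move=> q1 mv mg v0 g0 vfin gfin.
apply: (@le_lt_trans _ _ (\int[mu]_x (\1_(K i) x * v x)%:E +
    \int[mu]_x (g x `^ q * v x)%:E)%E); last first.
  by apply: lte_add_pinfty => //; rewrite -nnint_set.
have mi E : measurable E -> measurable_fun setT (\1_E : X -> R).
  by move=> mE'; exact: measurable_indic.
have mgq : measurable_fun setT (fun x => g x `^ q) by exact: measurable_powR_comp.
rewrite nnint_set -nnintD//; last 4 first.
- exact: measurable_funM.
- exact: measurable_funM.
- by move=> x; rewrite mulr_ge0.
- by move=> x; rewrite mulr_ge0// powR_ge0.
apply: nnint_le.
- by apply: measurable_funM => //; exact: measurable_funM.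
- by apply: measurable_funD => //; exact: measurable_funM.
- by move=> x; rewrite !mulr_ge0.
move=> x; rewrite mulrA -mulrDl ler_wpM2r// indicE.
have [Bx|Bx] := pselect (B i x); last first.
  by rewrite memNset// mul0r addr_ge0// powR_ge0.
rewrite mem_set// mul1r indicE mem_set; last exact: BK.
have [g1|/ltW g1] := leP (g x) 1.
  by rewrite (le_trans g1)// lerDl powR_ge0.
apply: (@le_trans _ _ (g x `^ q)); last by rewrite lerDr.
by apply: le1r_powR => //; exact: ltW.
Qed.

Let ms : measurable_fun setT s. Proof. exact: measurable_powR_comp. Qed.
Let s0 x : 0 <= s x. Proof. exact: powR_ge0. Qed.

(* This is [f / s] where [w] does not vanish. *)
Let g x := f x * w x `^ (p - 1)^-1.
Let mg : measurable_fun setT g.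
Proof. by apply: measurable_funM => //; exact: measurable_powR_comp. Qed.
Let g0 x : 0 <= g x. Proof. by rewrite mulr_ge0// powR_ge0. Qed.

Let gsE x : w x != 0 -> g x * s x = f x.
Proof.
move=> wx; rewrite /g /s powRN -mulrA divff ?mulr1//.
by rewrite powR_eq0 (negbTE wx).
Qed.

Let gpsE x : g x `^ p * s x = f x `^ p * w x.
Proof.
have [wx|wx] := eqVneq (w x) 0.
  rewrite /s wx mulr0 powR0 ?mulr0// oppr_eq0 invr_eq0; apply/eqP; move: pm1; lra.
rewrite /g /s powRM ?powR_ge0// -powRrM -mulrA; congr (_ * _).
rewrite -powRD; last by rewrite wx implybT.
rewrite -[RHS]powRr1//; congr (_ `^ _).
by field; apply/eqP; move: pm1; lra.
Qed.

Let a i := fine (\int[mu]_(x in B i) (g x * s x)%:E) / S i.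

Let a0 i : 0 <= a i.
Proof.
rewrite divr_ge0 ?(ltW (S0 i))// fine_ge0// integral_ge0// => x _.
by rewrite lee_fin mulr_ge0.
Qed.

Let gps_int : (\int[mu]_x (g x `^ p * s x)%:E = \int[mu]_x (f x `^ p * w x)%:E)%E.
Proof. by apply: eq_integral => x _; rewrite gpsE. Qed.

Lemma Lp_locally_integrable i : (\int[mu]_(x in B i) (f x)%:E < +oo)%E.
Proof.
rewrite (@eq_int_off_null i f (fun x => g x * s x))//.
- by apply: (@avg_fin i s g p) => //; rewrite ?SE ?ltry// gps_int.
- exact: measurable_funM.
- by move=> x; rewrite mulr_ge0.
- by move=> x wx; rewrite gsE.
Qed.

Let aE i : ((a i)%:E * \int[mu]_(x in K i) (s x)%:E
  = \int[mu]_(x in B i) (g x * s x)%:E)%E.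
Proof.
have ge0 : (0 <= \int[mu]_(x in B i) (g x * s x)%:E)%E.
  by apply: integral_ge0 => x _; rewrite lee_fin mulr_ge0.
rewrite SE -EFinM divfK ?gt_eqF// fineK// ge0_fin_numE//.
by apply: (@avg_fin i s g p) => //; rewrite ?SE ?ltry// gps_int.
Qed.

Variable N : nat.
Let M := finmax a B N.
Let mM : measurable_fun setT M. Proof. exact: measurable_finmax. Qed.
Let M0 x : 0 <= M x. Proof. exact: finmax_ge0. Qed.

(* This is [M ^ (p - 1) / w]; it turns the integrals of [M ^ (p - 1)] into integrals
   against the weight [w]. *)
Let h x := M x `^ (p - 1) * w x `^ (- 1).
Let mh : measurable_fun setT h.
Proof. by apply: measurable_funM; exact: measurable_powR_comp. Qed.
Let h0 x : 0 <= h x. Proof. by rewrite mulr_ge0// powR_ge0. Qed.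

Let hwE x : w x != 0 -> h x * w x = M x `^ (p - 1).
Proof. by move=> wx; rewrite /h powR_inv1// divfK. Qed.

Let hpwE x : h x `^ p' * w x = M x `^ p * s x.
Proof.
have p'E : (p - 1) * p' = p by rewrite /p'; field; apply/eqP; move: pm1; lra.
have [wx|wx] := eqVneq (w x) 0.
  rewrite /s wx mulr0 powR0 ?mulr0// oppr_eq0 invr_eq0; apply/eqP; move: pm1; lra.
rewrite /h /s powRM ?powR_ge0// -!powRrM p'E -mulrA; congr (_ * _).
rewrite -[X in _ * X]powRr1// -powRD; last by rewrite wx implybT.
by congr (_ `^ _); rewrite /p'; field; apply/eqP; move: pm1; lra.
Qed.

Let M_int : (\int[mu]_x (M x `^ p * s x)%:E <=
  (2 * young_const p)%:E * \int[mu]_x (f x `^ p * w x)%:E)%E.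
Proof.
rewrite -gps_int; apply: (finmax_strong_type mB mK BK vit) => // i.
by rewrite SE ltry.
Qed.

Let hpw_int : (\int[mu]_x (h x `^ p' * w x)%:E = \int[mu]_x (M x `^ p * s x)%:E)%E.
Proof. by apply: eq_integral => x _; rewrite hpwE. Qed.

Let hpw_fin : (\int[mu]_x (h x `^ p' * w x)%:E < +oo)%E.
Proof.
rewrite hpw_int; apply: le_lt_trans M_int _; apply: lte_mul_pinfty => //.
by rewrite lee_fin mulr_ge0// ltW// young_const_gt0.
Qed.

Let b i := fine (\int[mu]_(x in B i) (h x * w x)%:E) / W i.

Let b0 i : 0 <= b i.
Proof.
rewrite divr_ge0 ?(ltW (W0 i))// fine_ge0// integral_ge0// => x _.
by rewrite lee_fin mulr_ge0.
Qed.

Let bE i : ((b i)%:E * \int[mu]_(x in K i) (w x)%:E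
  = \int[mu]_(x in B i) (h x * w x)%:E)%E.
Proof.
have ge0 : (0 <= \int[mu]_(x in B i) (h x * w x)%:E)%E.
  by apply: integral_ge0 => x _; rewrite lee_fin mulr_ge0.
rewrite WE -EFinM divfK ?gt_eqF// fineK// ge0_fin_numE//.
by apply: (@avg_fin i w h p') => //; rewrite ?WE ?ltry.
Qed.

Let caE i : c i * m i = a i * S i.
Proof.
apply/EFin_inj; rewrite !EFinM -mE -SE aE cE.
apply: eq_int_off_null => //.
- exact: measurable_funM.
- by move=> x; rewrite mulr_ge0.
- by move=> x wx; rewrite gsE.
Qed.

(* On [B i] the maximal function [M] is at least [a i]. *)
Let ab_le i : (i < N)%N -> a i `^ (p - 1) * m i <= b i * W i.
Proof.
move=> iN; rewrite -lee_fin !EFinM -mE -WE bE.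
rewrite -(integral_cst mu (mB i)).
rewrite (@eq_int_off_null i (fun x => h x * w x) (fun x => M x `^ (p - 1)))//.
- apply: ge0_le_integral => //.
  + by move=> x _; rewrite lee_fin powR_ge0.
  + apply/measurable_EFinP; apply: measurable_funTS; exact: measurable_powR_comp.
  + move=> x Bx; rewrite lee_fin; apply: ge0_ler_powR; rewrite ?nnegrE ?(ltW pm1)//.
    exact: le_finmax.
- exact: measurable_funM.
- exact: measurable_powR_comp.
- by move=> x; rewrite mulr_ge0.
- by move=> x; rewrite powR_ge0.
Qed.

(* The average [c i] is compared with the two weighted averages [a i] and [b i]; the
   masses that appear are exactly those of the [A_p] condition. *)
Let c_le i : (i < N)%N -> c i <= (A * C0 `^ p * b i) `^ (p - 1)^-1.
Proof.
move=> iN.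
have mp : 0 < m i `^ (p - 1) by rewrite powR_gt0.
suff cp : c i `^ (p - 1) <= A * C0 `^ p * b i.
  have -> : c i = (c i `^ (p - 1)) `^ (p - 1)^-1.
    by rewrite -powRrM divff ?powRr1// gt_eqF.
  apply: ge0_ler_powR; rewrite ?nnegrE ?invr_ge0 ?(ltW pm1) ?powR_ge0//.
  exact: mulr_ge0 (mulr_ge0 A0 (powR_ge0 _ _)) (b0 i).
rewrite -(ler_pM2r mp) -powRM// ?(ltW (m0 i))// caE powRM// ?(ltW (S0 i))//.
rewrite -(ler_pM2r (m0 i)).
apply: (@le_trans _ _ (b i * (W i * S i `^ (p - 1)))).
  by rewrite mulrAC mulrA ler_wpM2r ?powR_ge0// ab_le.
apply: (@le_trans _ _ (b i * (A * (C0 * m i) `^ p))); first by rewrite ler_wpM2l.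
rewrite powRM// ?(ltW (m0 i))// -(@powR_mul_pred _ (m i))// ?(ltW (m0 i))//.
by rewrite le_eqVlt; apply/orP; left; apply/eqP; ring.
Qed.

(** By [c_le] the maximal function of [f] is dominated by a power of the maximal
    function of [h] with weight [w], to which the strong type inequality applies
    with exponent [p']; the exponents are such that [h ^ p' w = M ^ p s] and
    [g ^ p s = f ^ p w], so a second application with exponent [p] closes the
    estimate. *)
Theorem finite_buckley :
  (\int[mu]_x (finmax c B N x `^ p * w x)%:E <=
   ((A * C0 `^ p) `^ p' * (2 * young_const p' * (2 * young_const p)))%:E
   * \int[mu]_x (f x `^ p * w x)%:E)%E.
Proof.
have Y1 := young_const_gt0 p1; have Y2 := young_const_gt0 p'1.
have Q0 : 0 <= (A * C0 `^ p) `^ p' by rewrite powR_ge0.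
have mfb : measurable_fun setT (finmax b B N) by exact: measurable_finmax.
apply: (@le_trans _ _ (((A * C0 `^ p) `^ p')%:E *
    \int[mu]_x (finmax b B N x `^ p' * w x)%:E)%E).
  rewrite -nnintZ//; last 2 first.
  - by apply: measurable_funM => //; exact: measurable_powR_comp.
  - by move=> x; rewrite mulr_ge0// powR_ge0.
  apply: nnint_le.
  - apply: measurable_funM => //; apply: measurable_powR_comp; exact: measurable_finmax.
  - by do ?apply: measurable_funM => //; exact: measurable_powR_comp.
  - by move=> x; rewrite mulr_ge0// powR_ge0.
  move=> x; rewrite mulrA ler_wpM2r//.
  have AC : 0 <= A * C0 `^ p by rewrite mulr_ge0// powR_ge0.
  have b_ge0 : 0 <= finmax b B N x by exact: finmax_ge0.
  have -> : (A * C0 `^ p) `^ p' * finmax b B N x `^ p' =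
      ((A * C0 `^ p * finmax b B N x) `^ (p - 1)^-1) `^ p.
    by rewrite -powRM// -powRrM [_^-1 * p]mulrC.
  apply: ge0_ler_powR; rewrite ?nnegrE ?finmax_ge0 ?powR_ge0 ?(ltW p_gt0)//.
  apply: finmax_le; first exact: powR_ge0.
  move=> i iN Bx; apply: le_trans (c_le iN) _.
  apply: ge0_ler_powR; rewrite ?nnegrE ?invr_ge0 ?(ltW pm1)//.
  - by rewrite mulr_ge0.
  - by rewrite mulr_ge0.
  - by rewrite ler_wpM2l// le_finmax.
rewrite EFinM -muleA; apply: lee_wpmul2l; first by rewrite lee_fin.
apply: (@le_trans _ _ ((2 * young_const p')%:E *
    \int[mu]_x (h x `^ p' * w x)%:E)%E).
  apply: (finmax_strong_type mB mK BK vit) => // i.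
  by rewrite WE ltry.
rewrite [in leRHS]EFinM -muleA; apply: lee_wpmul2l.
  by rewrite lee_fin mulr_ge0// ltW.
by rewrite hpw_int.
Qed.

End finite_buckley.

(** * Weights in the class A_p *)
(** The integral of a nonnegative function is a supremum over the simple functions
    below it, hence monotone without any measurability.  The maximal function is a
    supremum over uncountably many balls, none of which needs to be open, so it
    may fail to be measurable. *)
Lemma ge0_le_lower_integral d (X : measurableType d) (R : realType)
    (mu : {measure set X -> \bar R}) (D : set X) (f1 f2 : X -> \bar R) :
  (forall x, D x -> 0 <= f1 x)%E -> (forall x, D x -> f1 x <= f2 x)%E ->
  (\int[mu]_(x in D) f1 x <= \int[mu]_(x in D) f2 x)%E.
Proof.
move=> f10 f12; rewrite !ge0_integralE//; last first.
  by move=> x Dx; exact: le_trans (f10 _ Dx) (f12 _ Dx).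
apply: ereal_sup_le => _ [h hf <-]; exists h => // x.
by apply: le_trans (hf x) _; exact: lee_restrict.
Qed.

Lemma ge0_subset_lower_integral d (X : measurableType d) (R : realType)
    (mu : {measure set X -> \bar R}) (D E : set X) (f : X -> \bar R) :
  (forall x, 0 <= f x)%E -> D `<=` E ->
  (\int[mu]_(x in D) f x <= \int[mu]_(x in E) f x)%E.
Proof.
move=> f0 DE; rewrite integral_mkcond [leRHS]integral_mkcond.
apply: ge0_le_lower_integral => x _; first by apply: erestrict_ge0.
rewrite !patchE; case: ifPn => [|_]; first by rewrite inE => /DE Ex; rewrite mem_set.
by case: ifPn.
Qed.

Section Ap_weights.
Context (R : realType) d (X : measurableType d) (rho : X -> X -> R)
  (mu : {measure set X -> \bar R}) (p : R) (w : X -> R).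
Hypotheses (Hrho : quasi_metric rho) (Hmu : borel_doubling rho mu) (p1 : 1 < p).
Hypothesis Hw : is_Ap rho mu p w.

Let s x := w x `^ (- (p - 1)^-1).
Let pm1 : 0 < p - 1. Proof. by move: p1; lra. Qed.
Let w0 x : 0 <= w x. Proof. by case: Hw => -[]. Qed.
Let mw : measurable_fun setT w. Proof. by case: Hw => -[]. Qed.
Let ms : measurable_fun setT s. Proof. exact: measurable_powR_comp. Qed.
Let mqball x r : 0 < r -> measurable (qball rho x r).
Proof. by move=> r0; case: Hmu => _ + _ _; exact. Qed.

Lemma dual_weight_ge0 x : (0 <= dual_weight p w x)%E.
Proof. by rewrite inve_ge0 lee_fin powR_ge0. Qed.

Lemma le_dual_weight x : ((w x `^ (- (p - 1)^-1))%:E <= dual_weight p w x)%E.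
Proof.
by rewrite /dual_weight inver powRN; case: ifP => // _; rewrite leey.
Qed.

Lemma Ap_const_ge x r : 0 < r ->
  ((\int[mu]_(y in qball rho x r) (w y)%:E)
    * (\int[mu]_(y in qball rho x r) dual_weight p w y) `^ (p - 1)
    / (mu (qball rho x r)) `^ p <= Ap_const rho mu p w)%E.
Proof. by move=> r0; apply: ereal_sup_ubound; exists x, r. Qed.

Lemma Ap_const_ge0 : (0 <= Ap_const rho mu p w)%E.
Proof.
apply: le_trans (Ap_const_ge point ltr01); rewrite mule_ge0 ?inve_ge0 ?poweR_ge0//.
rewrite mule_ge0 ?poweR_ge0//; apply: integral_ge0 => x _; by rewrite lee_fin.
Qed.

Lemma Ap_const_fin_num : Ap_const rho mu p w \is a fin_num.
Proof. by rewrite ge0_fin_numE ?Ap_const_ge0//; case: Hw. Qed.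

Lemma weight_ball_fin x r : 0 < r ->
  (\int[mu]_(y in qball rho x r) (w y)%:E < +oo)%E.
Proof.
move=> r0; case: Hw => -[_ _ /(_ x r r0)] /integrableP[_] + _.
by under eq_integral do rewrite /= ger0_norm//.
Qed.

Lemma qball_measure x r : 0 < r -> exists2 t : R, 0 < t & mu (qball rho x r) = t%:E.
Proof.
move=> r0; case: Hmu => _ _ /(_ x r r0)/andP[m0 moo] _.
have mfin : mu (qball rho x r) \is a fin_num by rewrite ge0_fin_numE.
by exists (fine (mu (qball rho x r))); rewrite ?fineK// fine_gt0// m0.
Qed.

(** A positive mass is needed here, since the product of 0 and infinity is 0. *)
Lemma dual_ball_fin x r : 0 < r -> (0 < \int[mu]_(y in qball rho x r) (w y)%:E)%E ->
  (\int[mu]_(y in qball rho x r) dual_weight p w y < +oo)%E.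
Proof.
move=> r0 W0; rewrite ltey; apply/eqP => dualy.
have := Ap_const_ge x r0; have [t t0 ->] := qball_measure x r0.
rewrite dualy poweRyr ?gt_eqF// gt0_muley// poweR_EFin inver gt_eqF ?powR_gt0//.
rewrite gt0_mulye ?lte_fin ?invr_gt0 ?powR_gt0// leye_eq => /eqP Ay.
by case: Hw => _; rewrite Ay ltxx.
Qed.

Let mzero x r : 0 < r -> measurable (qball rho x r `&` [set y | w y = 0]).
Proof.
move=> r0; apply: measurableI; first exact: mqball.
exact: measurable_zero_set.
Qed.

(** The dual weight is infinite where [w] vanishes. *)
Lemma weight_zero_null x r : 0 < r ->
  (\int[mu]_(y in qball rho x r) dual_weight p w y < +oo)%E ->
  mu (qball rho x r `&` [set y | w y = 0]) = 0%E.
Proof.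
move=> r0; apply: contraPP => /eqP N0 /=; apply/negP; rewrite -leNgt.
set Z := _ `&` _ in N0.
apply: (@le_trans _ _ (\int[mu]_(y in Z) (cst +oo y))%E).
  by rewrite integral_cst; [rewrite gt0_mulye// lt0e N0 measure_ge0|exact: mzero].
apply: (@le_trans _ _ (\int[mu]_(y in Z) dual_weight p w y)%E).
  apply: ge0_le_lower_integral => y; first by rewrite leey.
  by move=> [_ /= wy]; rewrite /dual_weight wy powR0 ?inve0// invr_eq0 gt_eqF.
by apply: ge0_subset_lower_integral; [exact: dual_weight_ge0|move=> y []].
Qed.

Lemma integral_gt0_of_null (D : set X) (u : X -> R) : measurable D ->
  measurable_fun setT u -> (forall x, 0 <= u x) -> (0 < mu D)%E ->
  mu (D `&` [set y | u y = 0]) = 0%E -> (0 < \int[mu]_(y in D) (u y)%:E)%E.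
Proof.
move=> mD mu' u0 D0 null; rewrite lt_neqAle; apply/andP; split; last first.
  by apply: integral_ge0 => y _; rewrite lee_fin.
apply/eqP => int0.
have mu0 : measurable_fun D (EFin \o u) by apply/measurable_EFinP; exact: measurable_funTS.
have := ae_eq_integral_abs mu mD mu0.
under eq_integral do rewrite /= ger0_norm//.
move=> [/(_ (esym int0))[N [mN N0 sN]] _].
suff : (mu D <= 0)%E by rewrite leNgt D0.
have mZ : measurable (D `&` [set y | u y = 0]).
  by apply: measurableI => //; exact: measurable_zero_set.
have E0 : (mu (D `&` [set y | u y = 0%R]) + mu N = 0)%E by rewrite null N0 adde0.
rewrite -E0; apply: le_trans (measureU2 _ _ _) => //; apply: le_measure; rewrite ?inE//.
  exact: measurableU.
move=> y Dy; have [uy|uy] := pselect (u y = 0); first by left.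
by right; apply: sN => /= H; apply: uy; have [] := H Dy.
Qed.

(** A weight that vanishes almost everywhere satisfies the [A_p] condition with
    constant 0.  Any other weight has positive mass on some ball, and every ball
    lies in a larger one that contains this ball and hence has finite dual mass. *)
Lemma Ap_weight_dichotomy :
  (forall x r, 0 < r -> (\int[mu]_(y in qball rho x r) (w y)%:E = 0)%E) \/
  (forall x r, 0 < r ->
    [/\ (0 < \int[mu]_(y in qball rho x r) (w y)%:E)%E,
        (0 < \int[mu]_(y in qball rho x r) (w y `^ (- (p - 1)^-1))%:E)%E,
        (\int[mu]_(y in qball rho x r) dual_weight p w y < +oo)%E &
        mu (qball rho x r `&` [set y | w y = 0%R]) = 0%E]).
Proof.
have [?|] := pselect (forall x r, 0 < r ->
    (\int[mu]_(y in qball rho x r) (w y)%:E = 0)%E).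
  by left.
move=> /existsNP[x0 /existsNP[r0 /not_implyP[r0_gt0 /eqP W0]]]; right => x r r_gt0.
case: (Hrho) => rho0 rho_eq rho_sym [A A1 tri].
have A0 : 0 < A := lt_le_trans ltr01 A1.
(* A ball centred at [x] that contains both [B(x, r)] and [B(x0, r0)]. *)
have [Q [Q0 BQ B0Q]] : exists Q, [/\ 0 < Q, qball rho x r `<=` qball rho x Q &
    qball rho x0 r0 `<=` qball rho x Q].
  pose T := A * (r0 + (rho x0 x + 1)).
  have T0 : 0 < T by rewrite mulr_gt0// addr_gt0// ltr_wpDl.
  exists (Num.max r T); split; first by rewrite lt_max r_gt0.
    by apply: qball_le; rewrite le_max lexx.
  apply: subset_trans (@qball_le _ _ rho x T _ _); last by rewrite le_max lexx orbT.
  by apply: (qball_sub A1 tri); rewrite ltrDl.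
have Wpos : (0 < \int[mu]_(y in qball rho x0 r0) (w y)%:E)%E.
  by rewrite lt0e W0/=; apply: integral_ge0 => y _; rewrite lee_fin.
have WQ : (0 < \int[mu]_(y in qball rho x Q) (w y)%:E)%E.
  apply: lt_le_trans Wpos _; apply: ge0_subset_integral => //; try exact: mqball.
    by apply/measurable_EFinP; exact: measurable_funTS.
  by move=> y _; rewrite lee_fin.
have dQ := dual_ball_fin Q0 WQ.
have dfin : (\int[mu]_(y in qball rho x r) dual_weight p w y < +oo)%E.
  apply: le_lt_trans dQ.
  by apply: ge0_subset_lower_integral => //; exact: dual_weight_ge0.
have null := weight_zero_null r_gt0 dfin.
have mu0 : (0 < mu (qball rho x r))%E by have [t t0 ->] := qball_measure x r_gt0.
split => //; apply: integral_gt0_of_null => //; try exact: mqball.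
  by move=> y; exact: powR_ge0.
rewrite (_ : [set y | _] = [set y | w y = 0])//; apply/seteqP; split => y /=.
  by move/powR_eq0_eq0.
by move=> ->; rewrite powR0// oppr_eq0 invr_eq0 gt_eqF.
Qed.

End Ap_weights.

(** * The maximal theorem *)
Section maximal_theorem.
Context (R : realType) d (X : measurableType d) (rho : X -> X -> R)
  (mu : {measure set X -> \bar R}).
Hypotheses (Hrho : quasi_metric rho) (Hmu : borel_doubling rho mu).

Lemma doubling_ball_family : exists (z : nat -> X) (r : nat -> R) (k C : R),
  [/\ [/\ 0 < C, 1 <= k & forall i, 0 < r i],
      vitali_cover (fun i => qball rho (z i) (r i)) (fun i => qball rho (z i) (k * r i)),
      forall i, (mu (qball rho (z i) (k * r i)) <= C%:E * mu (qball rho (z i) (r i)))%E &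
      forall x s, 0 < s -> exists i, qball rho x s `<=` qball rho (z i) (r i) /\
        (mu (qball rho (z i) (r i)) <= C%:E * mu (qball rho x s))%E].
Proof.
have [z [r [l [r0 fam]]]] := countable_ball_family Hrho Hmu.
case: (Hrho) => rho0 rho_eq rho_sym [A A1 tri].
have rhoxx x : rho x x = 0 by apply/rho_eq.
have [C1 C10 HC1] := doubling_iter Hrho Hmu (3 * A ^+ 2).
have [C2 C20 HC2] := doubling_iter Hrho Hmu l.
exists z, r, (3 * A ^+ 2), (Num.max C1 C2); split.
- split => //; first by rewrite lt_max C10.
  have : 1 <= A ^+ 2 by rewrite exprn_ege1.
  lra.
- exact: vitali_cover_qball.
- move=> i; apply: le_trans (HC1 _ _ (r0 i)) _; apply: lee_wpmul2r => //.
  by rewrite lee_fin le_max lexx.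
- move=> x s s0; have [i [xi ix]] := fam x s s0; exists i; split => //.
  have mB : forall y t, 0 < t -> measurable (qball rho y t) by case: Hmu.
  have ls0 : 0 < l * s.
    have := ix _ (qball_center rhoxx (z i) (r0 i)).
    by apply: le_lt_trans; exact: rho0.
  apply: (@le_trans _ _ (mu (qball rho x (l * s)))).
    by apply: le_measure; rewrite ?inE//; exact: mB.
  apply: le_trans (HC2 _ _ s0) _; apply: lee_wpmul2r => //.
  by rewrite lee_fin le_max lexx orbT.
Qed.

Lemma integral_eq0_of_balls (w : X -> R) : measurable_fun setT w -> (forall x, 0 <= w x) ->
  (forall x r, 0 < r -> (\int[mu]_(y in qball rho x r) (w y)%:E = 0)%E) ->
  (\int[mu]_x (w x)%:E = 0)%E.
Proof.
move=> mw w0 wB.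
have mB : forall y t, 0 < t -> measurable (qball rho y t) by case: Hmu.
have mZ : measurable (~` [set x | w x = 0]) by apply/measurableC/measurable_zero_set.
have null n : mu.-negligible (qball rho point n.+1%:R `&` ~` [set x | w x = 0]).
  have mBn : measurable (qball rho point n.+1%:R) by exact: mB.
  have mwn : measurable_fun (qball rho point n.+1%:R) (EFin \o w).
    by apply/measurable_EFinP; exact: measurable_funTS.
  have := ae_eq_integral_abs mu mBn mwn.
  under eq_integral do rewrite /= ger0_norm//.
  move=> [/(_ (wB _ _ (ltr0Sn _ _)))[N [mN N0 sN]] _].
  exists N; split => // y [By wy]; apply: sN => /= H; apply: wy.
  by have [] := H By.
have {null} := negligible_bigcup null.
rewrite -setI_bigcupl (qball_bigcup Hrho) setTI => /negligibleP => /(_ mZ) null.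
rewrite (@ge0_ae_eq_integral _ _ _ mu setT _ (cst 0%E))//.
- by rewrite integral0.
- exact/measurable_EFinP.
- by move=> x _; rewrite lee_fin.
- exists (~` [set x | w x = 0]); split => // x /= /not_implyP[_ wx] w_x0.
  by apply: wx; rewrite w_x0.
Qed.

Variables (p : R) (p1 : 1 < p).
Let p_gt0 : 0 < p. Proof. by move: p1; lra. Qed.
Let pm1 : 0 < p - 1. Proof. by move: p1; lra. Qed.
Let mqball y t : 0 < t -> measurable (qball rho y t).
Proof. by move=> t0; case: Hmu => _ + _ _; exact. Qed.

Lemma HL_max_ge0 (f : X -> R) x : (0 <= HL_max rho mu f x)%E.
Proof.
case: (Hrho) => rho0 rho_eq _ _.
apply: le_ereal_sup_tmp; eexists.
  exists x, 1; last by reflexivity.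
  by split => //; rewrite /qball/= (_ : rho x x = 0)//; exact/rho_eq.
by rewrite mule_ge0 ?inve_ge0// integral_ge0// => y _; rewrite lee_fin.
Qed.

(** The maximal function may be infinite everywhere, but infinity times 0 is 0. *)
Lemma buckley_null (w f : X -> R) : measurable_fun setT w -> (forall x, 0 <= w x) ->
  (forall x r, 0 < r -> (\int[mu]_(y in qball rho x r) (w y)%:E = 0)%E) ->
  Lpw_norm mu p w (HL_max rho mu f) = 0%E.
Proof.
move=> mw w0 wB; rewrite /Lpw_norm.
suff -> : (\int[mu]_x (`|HL_max rho mu f x| `^ p * (w x)%:E) = 0)%E.
  by rewrite poweR0r// invr_eq0 gt_eqF.
apply/eqP; rewrite eq_le; apply/andP; split; last first.
  by apply: integral_ge0 => x _; rewrite mule_ge0 ?poweR_ge0 ?lee_fin.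
apply: (@le_trans _ _ (\int[mu]_x (+oo * (w x)%:E))%E).
  apply: ge0_le_lower_integral => x _; first by rewrite mule_ge0 ?poweR_ge0 ?lee_fin.
  by apply: lee_wpmul2r; rewrite ?lee_fin// leey.
rewrite ge0_integralZl//; [|exact/measurable_EFinP|by move=> x _; rewrite lee_fin].
by rewrite integral_eq0_of_balls// mule0.
Qed.

Lemma Ap_real (w : X -> R) x r (t W S : R) : is_Ap rho mu p w -> 0 < r -> 0 < t ->
  0 <= S -> mu (qball rho x r) = t%:E ->
  (\int[mu]_(y in qball rho x r) (w y)%:E)%E = W%:E ->
  (\int[mu]_(y in qball rho x r) (w y `^ (- (p - 1)^-1))%:E)%E = S%:E ->
  (\int[mu]_(y in qball rho x r) dual_weight p w y < +oo)%E ->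
  W * S `^ (p - 1) <= fine (Ap_const rho mu p w) * t `^ p.
Proof.
move=> Hw r0 t0 S0 tE WE SE dfin.
have W0 : 0 <= W.
  rewrite -lee_fin -WE integral_ge0// => y _; rewrite lee_fin.
  by case: Hw => -[].
have Afin := Ap_const_fin_num Hw.
have d0 : (0 <= \int[mu]_(y in qball rho x r) dual_weight p w y)%E.
  by apply: integral_ge0 => y _; exact: dual_weight_ge0.
have Sd : (S%:E <= \int[mu]_(y in qball rho x r) dual_weight p w y)%E.
  rewrite -SE; apply: ge0_le_lower_integral => y _; last exact: le_dual_weight.
  by rewrite lee_fin powR_ge0.
have := Ap_const_ge rho mu p w x r0.
rewrite WE tE -(fineK Afin) poweR_EFin inver gt_eqF ?powR_gt0//.
move: dfin d0 Sd; case: (\int[mu]_(y in qball rho x r) dual_weight p w y)%E => [D| |]// _.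
move=> D0 SD; rewrite poweR_EFin -!EFinM lee_fin ler_pdivrMr ?powR_gt0//.
move: D0 SD; rewrite !lee_fin => D0 SD; apply: le_trans; apply: ler_wpM2l => //.
by apply: ge0_ler_powR; rewrite ?nnegrE ?(ltW pm1).
Qed.

(** Each ball lies in a member of the countable family of comparable measure, so its
    average is at most [C] times that of this member. *)
Lemma HL_max_le_family (z : nat -> X) (r : nat -> R) (C : R) (m c : nat -> R)
    (f : X -> R) (x : X) (t : \bar R) : 0 <= C -> measurable_fun setT f ->
  (forall i, 0 < r i) -> (forall i, 0 < m i) -> (forall i, 0 <= c i) ->
  (forall i, mu (qball rho (z i) (r i)) = (m i)%:E) ->
  (forall i, ((c i)%:E * mu (qball rho (z i) (r i)) =
     \int[mu]_(y in qball rho (z i) (r i)) `|f y|%:E)%E) ->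
  (forall y s, 0 < s -> exists i, qball rho y s `<=` qball rho (z i) (r i) /\
        (mu (qball rho (z i) (r i)) <= C%:E * mu (qball rho y s))%E) ->
  (forall N, ((C * finmax c (fun i => qball rho (z i) (r i)) N x)%:E <= t)%E) ->
  (HL_max rho mu f x <= t)%E.
Proof.
move=> C0 mf r0 m0 c0 mE cE fam Ht; apply: ge_ereal_sup => _ [y [s [s0 Byx] ->]].
have [i [sub meas]] := fam y s s0.
apply: (le_trans _ (Ht i.+1)).
have [u u0 uE] := qball_measure Hmu y s0.
have int_le : (\int[mu]_(v in qball rho y s) `|f v|%:E <= (c i * m i)%:E)%E.
  rewrite EFinM -mE cE; apply: ge0_subset_integral => //; try exact: mqball.
  by apply/measurable_EFinP; apply: measurable_funTS; exact: measurableT_comp.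
rewrite uE inver gt_eqF//.
apply: (@le_trans _ _ (u^-1%:E * (c i * m i)%:E)%E).
  by apply: lee_wpmul2l => //; rewrite lee_fin invr_ge0 ltW.
rewrite -EFinM lee_fin mulrC ler_pdivrMr//.
have muC : m i <= C * u by rewrite -lee_fin EFinM -uE -mE.
apply: (@le_trans _ _ (c i * (C * u))); first by rewrite ler_wpM2l.
rewrite mulrA ler_wpM2r ?(ltW u0)// mulrC ler_wpM2l//.
by apply: (@le_finmax _ _ c (fun i => qball rho (z i) (r i))) => //; exact: sub.
Qed.

Lemma Lpw_norm_EFin (w f : X -> R) : Lpw_norm mu p w (EFin \o f) =
  ((\int[mu]_x (`|f x| `^ p * w x)%:E) `^ p^-1)%E.
Proof. by []. Qed.

(** The maximal functions of the first [N] members of the countable family increase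
    with [N]; their weighted [p]-th powers have a measurable limit [G], to which
    the uniform bound passes and which dominates that of the full maximal
    function. *)
Lemma buckley_nondegenerate : exists C : R, 0 < C /\
  forall w, is_Ap rho mu p w ->
  (forall x r, 0 < r ->
    [/\ (0 < \int[mu]_(y in qball rho x r) (w y)%:E)%E,
        (0 < \int[mu]_(y in qball rho x r) (w y `^ (- (p - 1)^-1))%:E)%E,
        (\int[mu]_(y in qball rho x r) dual_weight p w y < +oo)%E &
        mu (qball rho x r `&` [set y | w y = 0%R]) = 0%E]) ->
  forall f, in_Lpw mu p w f ->
    (Lpw_norm mu p w (HL_max rho mu f)
     <= C%:E * (Ap_const rho mu p w) `^ ((p - 1)^-1)
        * Lpw_norm mu p w (EFin \o f))%E.
Proof.
have [z [r [k [C [[C0 k1 r0] vit KB fam]]]]] := doubling_ball_family.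
pose B i := qball rho (z i) (r i); pose K i := qball rho (z i) (k * r i).
have kr0 i : 0 < k * r i by rewrite mulr_gt0// (lt_le_trans _ k1).
have mB i : measurable (B i) by exact: mqball.
have mK i : measurable (K i) by exact: mqball.
have BK i : B i `<=` K i by apply: qball_le; rewrite ler_peMl// ltW.
pose p' := p / (p - 1).
have p'1 : 1 < p' by rewrite /p' ltr_pdivlMr//; move: p1; lra.
pose D := 2 * young_const p' * (2 * young_const p).
have D0 : 0 < D by apply: mulr_gt0; apply: mulr_gt0 => //; exact: young_const_gt0.
(* The [p]-th root of the constant of [finite_buckley], apart from the power of the
   [A_p] constant, times the factor [C] lost in passing to the countable family. *)
exists (C * ((C `^ p) `^ (p - 1)^-1 * D `^ p^-1)); split.
  by rewrite !mulr_gt0// !powR_gt0.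
move=> w Hw nondeg f [mf ffin].
have [[w0 mw wint] _] := Hw.
pose A := fine (Ap_const rho mu p w).
have AE : Ap_const rho mu p w = A%:E by rewrite /A fineK//; exact: Ap_const_fin_num Hw.
have A0 : 0 <= A by rewrite -lee_fin -AE; exact: Ap_const_ge0 Hw.
pose I := (\int[mu]_x (`|f x| `^ p * w x)%:E)%E.
have I0 : (0 <= I)%E by apply: nnint_ge0 => x; rewrite mulr_ge0// powR_ge0.
have Ifin : (I < +oo)%E.
  by move: ffin; rewrite Lpw_norm_EFin; apply: lty_poweRy; rewrite invr_eq0 gt_eqF.
pose m i := fine (mu (B i)).
have mE i : mu (B i) = (m i)%:E.
  by rewrite /m; have [t _ ->] := qball_measure Hmu (z i) (r0 i).
have m0 i : 0 < m i.
  by rewrite /m; have [t ? ->] := qball_measure Hmu (z i) (r0 i).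
pose W i := fine (\int[mu]_(y in K i) (w y)%:E).
have WE i : (\int[mu]_(y in K i) (w y)%:E)%E = (W i)%:E.
  rewrite /W fineK// ge0_fin_numE; first exact: weight_ball_fin Hw _ _ (kr0 i).
  by apply: integral_ge0 => y _; rewrite lee_fin.
have W0 i : 0 < W i by rewrite -lte_fin -WE; case: (nondeg (z i) _ (kr0 i)).
pose S i := fine (\int[mu]_(y in K i) (w y `^ (- (p - 1)^-1))%:E).
have SE i : (\int[mu]_(y in K i) (w y `^ (- (p - 1)^-1))%:E)%E = (S i)%:E.
  rewrite /S fineK// ge0_fin_numE; last first.
    by apply: integral_ge0 => y _; rewrite lee_fin powR_ge0.
  case: (nondeg (z i) _ (kr0 i)) => _ _ + _; apply: le_lt_trans.
  apply: ge0_le_lower_integral => y _; last exact: le_dual_weight.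
  by rewrite lee_fin powR_ge0.
have S0 i : 0 < S i by rewrite -lte_fin -SE; case: (nondeg (z i) _ (kr0 i)).
have wB i : mu (B i `&` [set x | w x = 0]) = 0%E by case: (nondeg (z i) _ (r0 i)).
have Ap i : W i * S i `^ (p - 1) <= A * (C * m i) `^ p.
  have [t t0 tE] := qball_measure Hmu (z i) (kr0 i).
  case: (nondeg (z i) _ (kr0 i)) => _ _ dfin _.
  apply: le_trans (Ap_real Hw (kr0 i) t0 (ltW (S0 i)) tE (WE i) (SE i) dfin) _.
  apply: ler_wpM2l => //; apply: ge0_ler_powR; rewrite ?nnegrE ?(ltW p_gt0) ?(ltW t0)//.
    by rewrite mulr_ge0// ltW.
  by rewrite -lee_fin EFinM -tE -mE; exact: KB.
have mnf : measurable_fun setT (fun x => `|f x|) by exact: measurableT_comp.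
have nf0 x : 0 <= `|f x| by [].
pose c i := fine (\int[mu]_(y in B i) `|f y|%:E) / m i.
have fint0 i : (0 <= \int[mu]_(y in B i) `|f y|%:E)%E.
  by apply: integral_ge0 => y _; rewrite lee_fin.
have c0 i : 0 <= c i by rewrite divr_ge0 ?fine_ge0// ltW.
have cE i : ((c i)%:E * mu (B i) = \int[mu]_(x in B i) `|f x|%:E)%E.
  rewrite mE -EFinM divfK ?gt_eqF// fineK// ge0_fin_numE//.
  exact: (Lp_locally_integrable mB mK BK p1 mw w0 mnf nf0 SE wB Ifin).
have bound N := finite_buckley mB mK BK vit p1 A0 (ltW C0) mw w0 mnf nf0 W0 S0 m0 c0
  WE SE mE cE wB Ap Ifin N.
pose u N x := (C * finmax c B N x) `^ p * w x.
have Cf0 N x : 0 <= C * finmax c B N x by rewrite mulr_ge0 ?finmax_ge0// ltW.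
have u0 N x : 0 <= u N x by rewrite mulr_ge0// powR_ge0.
have mfm N : measurable_fun setT (finmax c B N) by exact: measurable_finmax.
have mu_ N : measurable_fun setT (u N).
  apply: measurable_funM => //; apply: measurable_powR_comp.
  exact: measurable_funM.
have und x : {homo (fun N => (u N x)%:E) : a b / (a <= b)%N >-> (a <= b)%E}.
  move=> a b ab; rewrite lee_fin ler_wpM2r//.
  apply: ge0_ler_powR; rewrite ?nnegrE ?(ltW p_gt0)// ler_wpM2l ?(ltW C0)//.
  exact: finmax_homo.
have ucvg x : cvgn (fun N => (u N x)%:E).
  by apply: ereal_nondecreasing_is_cvgn => a b; exact: und.
pose G x := limn (fun N => (u N x)%:E).
have uG N x : ((u N x)%:E <= G x)%E.
  rewrite /G; apply: lime_ge => //; exists N => // n /= Nn; exact: und.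
have G0 x : (0 <= G x)%E by apply: le_trans (uG 0 x); rewrite lee_fin.
pose Q := C `^ p * ((A * C `^ p) `^ p' * D).
have Q0 : 0 <= Q := mulr_ge0 (powR_ge0 _ _) (mulr_ge0 (powR_ge0 _ _) (ltW D0)).
have uint N : (\int[mu]_x (u N x)%:E <= Q%:E * I)%E.
  rewrite (_ : \int[mu]_x _ = (C `^ p)%:E * \int[mu]_x (finmax c B N x `^ p * w x)%:E)%E.
    rewrite /Q EFinM -muleA; apply: lee_wpmul2l; first by rewrite lee_fin powR_ge0.
    exact: bound.
  rewrite -nnintZ ?powR_ge0//.
  - apply: eq_integral => x _; rewrite /u powRM ?finmax_ge0 ?(ltW C0)//.
    by rewrite mulrA.
  - by apply: measurable_funM => //; exact: measurable_powR_comp.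
  - by move=> x; rewrite mulr_ge0// powR_ge0.
have Gint : (\int[mu]_x G x <= Q%:E * I)%E.
  rewrite monotone_convergence//; first last.
  - by move=> N x _; rewrite lee_fin.
  - by move=> N; exact/measurable_EFinP.
  - apply: lime_le; last by apply: nearW => N; exact: uint.
    apply: ereal_nondecreasing_is_cvgn => a b ab; apply: nnint_le => //.
    by move=> x; rewrite -lee_fin; exact: und.
have ptw x : (`|HL_max rho mu f x| `^ p * (w x)%:E <= G x)%E.
  rewrite gee0_abs ?HL_max_ge0//.
  have [wx|wx] := eqVneq (w x) 0; first by rewrite wx mule0.
  have wx0 : 0 < w x by rewrite lt_neqAle eq_sym wx w0.
  (* Dividing by [w x] and taking roots reduces the claim to the averages, over
     which the maximal function is a supremum. *)
  rewrite -lee_pdivlMr//.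
  set T := (G x * _)%E.
  have T0 : (0 <= T)%E by rewrite mule_ge0 ?lee_fin// invr_ge0 ltW.
  have -> : T = ((T `^ p^-1) `^ p)%E by rewrite -poweRrM mulVf ?poweRe1// gt_eqF.
  apply: gt0_ler_poweR; rewrite ?(ltW p_gt0)// ?in_itv/= ?leey ?andbT ?HL_max_ge0 ?poweR_ge0//.
  apply: (HL_max_le_family (ltW C0) mf r0 m0 c0 mE cE fam) => N.
  have -> : (C * finmax c B N x)%:E = (((C * finmax c B N x)%:E `^ p) `^ p^-1)%E.
    by rewrite -poweRrM divff ?poweRe1 ?lee_fin// gt_eqF.
  apply: gt0_ler_poweR; rewrite ?invr_ge0 ?(ltW p_gt0)// ?in_itv/= ?leey ?andbT ?poweR_ge0//.
    by rewrite lee_fin powR_ge0.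
  by rewrite /T lee_pdivlMr// -EFinM; exact: uG.
rewrite Lpw_norm_EFin -/I AE poweR_EFin.
have -> : ((C * ((C `^ p) `^ (p - 1)^-1 * D `^ p^-1))%:E * (A `^ (p - 1)^-1)%:E * I `^ p^-1
   = (Q%:E * I) `^ p^-1)%E.
  rewrite poweRM ?lee_fin// poweR_EFin -EFinM; congr (_%:E * _)%E.
  have PD0 : 0 <= (A * C `^ p) `^ p' * D := mulr_ge0 (powR_ge0 _ _) (ltW D0).
  rewrite /Q (powRM _ (powR_ge0 _ _) PD0) (powRM _ (powR_ge0 _ _) (ltW D0)) -!powRrM.
  rewrite divff ?gt_eqF// powRr1 ?(ltW C0)//.
  rewrite (_ : p' / p = (p - 1)^-1); last first.
    by rewrite /p'; field; apply/andP; split; apply/eqP; move: p1; lra.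
  by rewrite (powRM _ A0 (powR_ge0 _ _)) -powRrM; ring.
rewrite /Lpw_norm; apply: gt0_ler_poweR; rewrite ?invr_ge0 ?(ltW p_gt0)//.
- rewrite in_itv/= leey andbT; apply: integral_ge0 => x _.
  by rewrite mule_ge0 ?poweR_ge0 ?lee_fin.
- by rewrite in_itv/= leey andbT mule_ge0 ?lee_fin.
apply: le_trans Gint; apply: ge0_le_lower_integral => x _ //.
by rewrite mule_ge0 ?poweR_ge0 ?lee_fin.
Qed.

End maximal_theorem.

Theorem proposition7p13 (R : realType) (d : measure_display)
    (X : measurableType d) (rho : X -> X -> R)
    (mu : {measure set X -> \bar R}) (p : R)
    (Hrho : quasi_metric rho) (Hmu : borel_doubling rho mu)
    (Hp : (1 < p)%R) :
  exists C : R, (0 < C)%R /\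
    forall w : X -> R, is_Ap rho mu p w ->
    forall f : X -> R, in_Lpw mu p w f ->
    (Lpw_norm mu p w (HL_max rho mu f)
     <= C%:E * (Ap_const rho mu p w) `^ ((p - 1)^-1)
        * Lpw_norm mu p w (EFin \o f))%E.
Proof.
have [C [C0 HC]] := buckley_nondegenerate Hrho Hmu Hp.
exists C; split => // w Hw f Hf.
have [wB|nondeg] := Ap_weight_dichotomy Hrho Hmu Hp Hw; last exact: HC.
case: (Hw) => -[w0 mw _] _.
rewrite (buckley_null Hrho Hmu Hp)// !mule_ge0 ?poweR_ge0//.
by rewrite lee_fin ltW.
Qed.
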